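(* Let $\Psi$ be a stationary point process on $\mathbb{R}^d$ with intensity $\alpha\ge1$ such that $$\sum_{w\in\mathbb{Z}^d}\mathbb{P}\big(F(\mathbb{Z}^d,\Psi,0)\not\subset B(0,\|w\|)\big)<\infty.$$ Then $\Psi_0^\tau:=\{x\in\Psi:\tau(\mathbb{Z}^d,\Psi,x)\ne\infty\}$ is a number rigid point process.
   Context: $\mathbf{N}$ is the space of locally finite subsets $\varphi$ of $\mathbb{R}^d$, with the $\sigma$-field generated by the maps $\varphi\mapsto\varphi(B):=\mathrm{card}(\varphi\cap B)$, $B$ Borel. A point process is a random element of $\mathbf{N}$; it is stationary if $\Psi+x$ has the same distribution as $\Psi$ for all $x\in\mathbb{R}^d$, and then its intensity is $\alpha:=\mathbb{E}\Psi([0,1]^d)$. $\|\cdot\|$ is the Euclidean norm and $B(z,r)$ is the closed ball with centre $z$ and radius $r$. Number rigidity. A point process $\Psi'$ on $\mathbb{R}^d$ is number rigid if for each closed ball $A\subset\mathbb{R}^d$ centred at the origin, the random number $\Psi'(A)$ is almost surely determined by $\Psi'\cap A^c$ (i.e. it is almost surely equal to a measurable function of $\Psi'\cap A^c$). This is equivalent to the same property for all bounded Borel sets in place of $A$. Matching. Let $\varphi,\psi\in\mathbf{N}$. A point $p\in\varphi$ prefers $x\in\psi$ to $y\in\psi$ if $\|x-p\|<\|y-p\|$, or if $\|x-p\|=\|y-p\|$ and $x$ is lexicographically strictly smaller than $y$. A point $x\in\psi$ prefers $p\in\varphi$ to $q\in\varphi$ if $\|p-x\|<\|q-x\|$, or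 if $\|p-x\|=\|q-x\|$ and $p$ is lexicographically strictly greater than $q$. The mutual nearest neighbour matching $\tau(\varphi,\psi,\cdot)$ is defined as follows: put $\varphi_0:=\varphi$, $\psi_0:=\psi$. Given $\varphi_n,\psi_n$, for each pair $(p,x)\in\varphi_n\times\psi_n$ such that $p$ prefers $x$ to all other points of $\psi_n$ and $x$ prefers $p$ to all other points of $\varphi_n$, set $\tau(\varphi,\psi,p):=x$ and $\tau(\varphi,\psi,x):=p$; let $\varphi_{n+1}\subset\varphi_n$, $\psi_{n+1}\subset\psi_n$ be the points not matched in this step. Points of $\varphi_\infty:=\bigcap_n\varphi_n$ and $\psi_\infty:=\bigcap_n\psi_n$ are never matched and get $\tau(\varphi,\psi,x):=\infty$. For $x\notin\varphi\cup\psi$ put $\tau(\varphi,\psi,x):=x$. Matching flower. For $n\ge2$, a sequence $(z_1,\dots,z_n)$ is a descending chain in $(\varphi,\psi)$ if $z_i\in\varphi$ for odd $i$, $z_i\in\psi$ for even $i$, and $z_i$ prefers $z_{i+1}$ to $z_{i-1}$ for $2\le i\le n-1$. For $z\in\varphi$ with $\tau(\varphi,\psi,z)\neq\infty$, a competing chain for $z$ is a descending chain $c=(z_1,\dots,z_n)$ with $z_1=z$ such that $z_2$ equals $\tau(\varphi,\psi,z)$ or is preferred by $z$ to $\tau(\varphi,\psi,z)$; put $F_c:=B(z_1,\|z_1-z_2\|)\cup\bigcup_{i=2}^nB(z_i,\|z_i-z_{i-1}\|)$. The matching flower is $F(\varphi,\psi,z):=\bigcup_cF_c$, the union over all competing chains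 $c$ for $z$. If $\tau(\varphi,\psi,z)=\infty$, then $F(\varphi,\psi,z):=\mathbb{R}^d$. *)

(* Defs.v *)
From HB Require Import structures.
From mathcomp Require Import all_boot all_order all_algebra.
From mathcomp Require Import all_classical all_reals all_analysis.
From mathcomp Require Import measurable_realfun.

Set Implicit Arguments.
Unset Strict Implicit.
Unset Printing Implicit Defensive.

Import Order.TTheory GRing.Theory Num.Theory.
Import numFieldNormedType.Exports.

Local Open Scope classical_set_scope.
Local Open Scope ring_scope.

Section Space.
Context (R : realType) (d : nat).
Local Notation point := 'rV[R]_d.

(* The library norm on ['rV[R]_d] is the sup norm. *)
Definition enorm (x : point) : R := Num.sqrt (\sum_(i < d) x 0 i ^+ 2).

Definition cball (z : point) (r : R) : set point :=
  [set y | enorm (y - z) <= r].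

Definition lexlt (x y : point) : Prop :=
  exists i : 'I_d, (forall j : 'I_d, (j < i)%N -> x 0 j = y 0 j) /\
    x 0 i < y 0 i.

Definition borel : set (set point) := <<s [set U : set point | open U] >>.

Definition Zd : set point := [set x | forall i : 'I_d, x 0 i \is a Num.int].

Definition unit_cube : set point :=
  [set x | forall i : 'I_d, 0 <= x 0 i <= 1].

Definition locally_finite (phi : set point) : Prop :=
  forall B : set point, bounded_set B -> finite_set (phi `&` B).

Lemma locally_finite_sub (phi psi : set point) :
  phi `<=` psi -> locally_finite psi -> locally_finite phi.
Proof.
move=> phipsi psi_lf B /psi_lf; apply: sub_finite_set => x [/phipsi psix Bx].
by split.
Qed.

Lemma locally_finite_shift (x : point) (phi : set point) :
  locally_finite phi -> locally_finite [set y + x | y in phi].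
Proof.
move=> phi_lf B Bb.
have Bxb : bounded_set [set z - x | z in B].
  move: Bb => [M [Mr HM]]; exists (M + `|x|); split => [|r Mr' _ [z Bz <-]].
    exact: num_real.
  apply: (le_trans (ler_normB _ _)); rewrite -lerBrDr.
  by apply: (HM (r - `|x|)) => //; rewrite ltrBrDr.
apply: (@sub_finite_set _ _ [set y + x | y in phi `&` [set z - x | z in B]]).
  move=> _ [[y phiy <-] Byx]; exists y => //; split => //.
  by exists (y + x) => //; rewrite addrK.
exact/finite_image/phi_lf.
Qed.

End Space.

Arguments Zd {R d}.
Arguments unit_cube {R d}.

(* The space N of locally finite subsets of R^d. *)
Record lfset (R : realType) (d : nat) := LFSet {
  pts :> set 'rV[R]_d;
  lfsetP : locally_finite pts }.

Section LFSetSpace.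
Context (R : realType) (d : nat).
Local Notation point := 'rV[R]_d.
Local Notation N := (lfset R d).

Lemma locally_finite0 : locally_finite (@set0 point).
Proof. by move=> B _; rewrite set0I. Qed.

HB.instance Definition _ := gen_eqMixin N.
HB.instance Definition _ := gen_choiceMixin N.
HB.instance Definition _ := isPointed.Build N (LFSet locally_finite0).

Definition lfcount (B : set point) (phi : N) : \bar R :=
  counting (pts phi `&` B).

Definition lfset_measurable : set (set N) :=
  <<s \bigcup_(B in @borel R d)
        preimage_set_system [set: N] (lfcount B) measurable >>.

Let lfset_measurable0 : lfset_measurable set0.
Proof. exact: sigma_algebra0. Qed.

Let lfset_measurableC (U : set N) :
  lfset_measurable U -> lfset_measurable (~` U).
Proof. exact: sigma_algebraC. Qed.

Let lfset_measurableU (F : (set N)^nat) :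
  (forall i, lfset_measurable (F i)) -> lfset_measurable (\bigcup_i F i).
Proof. exact: sigma_algebra_bigcup. Qed.

Definition lfset_display : measure_display.
Proof. by constructor. Qed.

HB.instance Definition _ :=
  @isMeasurable.Build lfset_display N lfset_measurable
    lfset_measurable0 lfset_measurableC lfset_measurableU.

Definition lfshift (x : point) (phi : N) : N :=
  LFSet (locally_finite_shift x (lfsetP phi)).

Definition lfrestrict (B : set point) (phi : N) : N :=
  LFSet (locally_finite_sub (@subIsetl _ (pts phi) B) (lfsetP phi)).

End LFSetSpace.

Section Matching.
Context (R : realType) (d : nat).
Local Notation point := 'rV[R]_d.
Implicit Types (phi psi : set point) (p q x y z : point).

(* [p], a point of the first set, prefers [x] to [y]. *)
Definition prefers1 p x y : Prop :=
  enorm (x - p) < enorm (y - p) \/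
  (enorm (x - p) = enorm (y - p) /\ lexlt x y).

(* [x], a point of the second set, prefers [p] to [q]; ties are broken in the
   direction opposite to [prefers1]. *)
Definition prefers2 x p q : Prop :=
  enorm (p - x) < enorm (q - x) \/
  (enorm (p - x) = enorm (q - x) /\ lexlt q p).

Definition mutual phi psi p x : Prop :=
  [/\ phi p, psi x,
      forall y, psi y -> y <> x -> prefers1 p x y &
      forall q, phi q -> q <> p -> prefers2 x p q].

(* The pair [(phi_n, psi_n)] of sets of points left after [n] steps. *)
Fixpoint remaining phi psi (n : nat) : set point * set point :=
  if n is m.+1 then
    let: (phim, psim) := remaining phi psi m in
    ([set p | phim p /\ ~ exists x, mutual phim psim p x],
     [set x | psim x /\ ~ exists p, mutual phim psim p x])
  else (phi, psi).

Definition matched phi psi p x : Prop :=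
  exists n, mutual (remaining phi psi n).1 (remaining phi psi n).2 p x.

(* [None] stands for the value [infty]. A point of [phi `&` psi] is matched to
   itself in the first step, in both of its roles, so a partner is unique. *)
Definition tau phi psi z : option point :=
  let partner := [set y | matched phi psi z y \/ matched phi psi y z] in
  if `[< phi z \/ psi z >] then
    if `[< partner !=set0 >] then Some (xget z partner) else None
  else Some z.

(* The chain is [z 1, ..., z n]; other values of [z] are irrelevant. *)
Definition descending_chain phi psi (n : nat) (z : nat -> point) : Prop :=
  [/\ (2 <= n)%N,
      forall i, (1 <= i <= n)%N -> if odd i then phi (z i) else psi (z i) &
      forall i, (2 <= i <= n.-1)%N ->
        if odd i then prefers1 (z i) (z i.+1) (z i.-1)
        else prefers2 (z i) (z i.+1) (z i.-1)].

Definition competing_chain phi psi z0 (n : nat) (z : nat -> point) : Prop :=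
  [/\ descending_chain phi psi n z, z 1%N = z0 &
      exists2 t, tau phi psi z0 = Some t &
        z 2%N = t \/ prefers1 z0 (z 2%N) t].

Definition chain_region (n : nat) (z : nat -> point) : set point :=
  cball (z 1%N) (enorm (z 1%N - z 2%N)) `|`
  \bigcup_(i in [set i : nat | (2 <= i <= n)%N])
    cball (z i) (enorm (z i - z i.-1)).

Definition flower phi psi z0 : set point :=
  if tau phi psi z0 is Some _ then
    \bigcup_(c in [set c : nat * (nat -> point) |
                  competing_chain phi psi z0 c.1 c.2]) chain_region c.1 c.2
  else setT.

Definition matched_points phi psi : set point :=
  [set x | psi x /\ tau phi psi x <> None].

Lemma matched_points_sub phi psi : matched_points phi psi `<=` psi.
Proof. by move=> x []. Qed.

Definition lfmatched phi (psi : lfset R d) : lfset R d :=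
  LFSet (locally_finite_sub (@matched_points_sub phi psi) (lfsetP psi)).

End Matching.

Section PointProcess.
Context (disp : measure_display) (Omega : measurableType disp) (R : realType)
        (d : nat) (P : probability Omega R).
Implicit Type X : Omega -> lfset R d.

Definition point_process X : Prop := measurable_fun [set: Omega] X.

Definition stationary X : Prop :=
  forall (x : 'rV[R]_d) (E : set (lfset R d)), measurable E ->
    pushforward P (fun w => lfshift x (X w)) E = pushforward P X E.

Definition intensity X : \bar R := (\int[P]_w lfcount unit_cube (X w))%E.

Definition number_rigid X : Prop :=
  forall r : R, 0 <= r ->
    exists2 g : lfset R d -> \bar R, measurable_fun [set: lfset R d] g &
      {ae P, forall w, lfcount (cball 0 r) (X w) =
                       g (lfrestrict (~` cball 0 r) (X w))}.

End PointProcess.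

(* Main.v *)
(* A lattice point has to be matched almost surely, since an unmatched one has an
   unbounded flower.  The matching of a lattice point [z] is decided inside its
   flower, so it can be computed from the matched points outside a ball [A] as
   soon as the flower of [z] misses [A].  By stationarity the probability that
   the flower of [z] leaves [B(z, s)] does not depend on [z], and writing
   [z = 2 u + v] with [v] in a finite set, Borel-Cantelli shows that almost
   surely all but finitely many [z] satisfy [F(z) <= B(z, |u|)], with
   [|u| <= |z| / 2]; hence only finitely many flowers meet [A].  Now let [W] be a
   finite set of lattice points containing all [z] whose flower meets [A].  The
   points of [W] are matched bijectively to the matched points in [A] and to the
   matched points outside [A] that are claimed by no lattice point outside [W].
   The latter are determined by the process outside [A], so the number of matched
   points in [A] is the difference of two numbers, for all large [W].  Exhausting
   the lattice by finite sets and taking a limit superior gives a measurable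
   function of the outside configuration. *)

Require Import Defs.
From mathcomp Require Import all_boot all_order all_algebra.
From mathcomp Require Import all_classical all_reals all_analysis.
From mathcomp Require Import measurable_realfun.
From mathcomp Require Import ring lra zify.

Set Implicit Arguments.
Unset Strict Implicit.
Unset Printing Implicit Defensive.

Import Order.TTheory GRing.Theory Num.Theory.
Import numFieldNormedType.Exports.

Local Open Scope classical_set_scope.
Local Open Scope ring_scope.

(** * The Euclidean norm and closed balls *)

Section EuclideanNorm.
Context (R : realType) (d : nat).
Local Notation point := 'rV[R]_d.
Implicit Types (p q x y z : point) (r s : R).

Let sumsq_ge0 x : 0 <= \sum_(i < d) x 0 i ^+ 2.
Proof. by apply: sumr_ge0 => i _; rewrite sqr_ge0. Qed.

Lemma enorm_ge0 x : 0 <= enorm x. Proof. exact: sqrtr_ge0. Qed.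

Lemma sqr_enorm x : enorm x ^+ 2 = \sum_(i < d) x 0 i ^+ 2.
Proof. by rewrite sqr_sqrtr ?sumsq_ge0. Qed.

Lemma enorm_coord x i : `|x 0 i| <= enorm x.
Proof.
rewrite -sqrtr_sqr ler_wsqrtr// (bigD1 i)//= lerDl.
by apply: sumr_ge0 => j _; rewrite sqr_ge0.
Qed.

Lemma enorm_eq0 x : enorm x = 0 -> x = 0.
Proof.
move=> x0; apply/rowP => i; apply/eqP; rewrite mxE -normr_le0 -x0.
exact: enorm_coord.
Qed.

Lemma enorm0 : enorm (0 : point) = 0.
Proof.
rewrite /enorm big1 ?sqrtr0// => i _.
by rewrite mxE expr0n.
Qed.

Lemma enormN x : enorm (- x) = enorm x.
Proof. by congr Num.sqrt; apply: eq_bigr => i _; rewrite mxE sqrrN. Qed.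

Lemma enormB x y : enorm (x - y) = enorm (y - x).
Proof. by rewrite -enormN opprB. Qed.

Lemma enormZ r x : enorm (r *: x) = `|r| * enorm x.
Proof.
rewrite -[RHS]ger0_norm ?mulr_ge0 ?enorm_ge0// -sqrtr_sqr.
congr Num.sqrt; rewrite exprMn sqr_enorm real_normK ?num_real// mulr_sumr.
by apply: eq_bigr => i _; rewrite mxE exprMn.
Qed.

(** Cauchy-Schwarz. With [a] and [b] the two norms and [C] the inner product, the sum of the squares
    of [b x_i - a y_i] is [2ab(ab - C)]. When [ab = 0] nothing can be divided out, but one of the
    vectors vanishes. *)
Lemma dotmul_le_enorm x y :
  \sum_(i < d) x 0 i * y 0 i <= enorm x * enorm y.
Proof.
set C := \sum_(i < d) _; set a := enorm x; set b := enorm y.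
have [a0 b0] : 0 <= a /\ 0 <= b by rewrite !enorm_ge0.
have [ab0|ab0] := eqVneq (a * b) 0.
  rewrite ab0 /C big1// => i _; move/eqP: ab0; rewrite mulf_eq0.
  by case/orP => /eqP/enorm_eq0 ->; rewrite mxE ?mul0r ?mulr0.
have abgt0 : 0 < a * b by rewrite lt_def ab0 mulr_ge0.
have : 0 <= \sum_(i < d) (b * x 0 i - a * y 0 i) ^+ 2.
  by apply: sumr_ge0 => i _; rewrite sqr_ge0.
have -> : \sum_(i < d) (b * x 0 i - a * y 0 i) ^+ 2 =
    b ^+ 2 * a ^+ 2 + a ^+ 2 * b ^+ 2 - (2 * (a * b)) * C.
  have -> : b ^+ 2 * a ^+ 2 = \sum_(i < d) b ^+ 2 * x 0 i ^+ 2.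
    by rewrite -mulr_sumr -sqr_enorm.
  have -> : a ^+ 2 * b ^+ 2 = \sum_(i < d) a ^+ 2 * y 0 i ^+ 2.
    by rewrite -mulr_sumr -sqr_enorm.
  rewrite /C mulr_sumr -big_split -sumrB /=.
  by apply: eq_bigr => i _; ring.
have -> : b ^+ 2 * a ^+ 2 + a ^+ 2 * b ^+ 2 - 2 * (a * b) * C =
   2 * (a * b) * (a * b - C) by ring.
by rewrite pmulr_rge0 ?subr_ge0// mulr_gt0.
Qed.

Lemma ler_enormD x y : enorm (x + y) <= enorm x + enorm y.
Proof.
rewrite -ler_sqr ?nnegrE ?addr_ge0 ?enorm_ge0// sqr_enorm sqrrD !sqr_enorm.
have -> : \sum_(i < d) (x + y) 0 i ^+ 2 = \sum_(i < d) x 0 i ^+ 2 +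
    (\sum_(i < d) x 0 i * y 0 i) *+ 2 + \sum_(i < d) y 0 i ^+ 2.
  rewrite -sumrMnl -!big_split /=; apply: eq_bigr => i _.
  by rewrite mxE; ring.
by rewrite lerD2r lerD2l lerMn2r dotmul_le_enorm orbT.
Qed.

Lemma ler_enorm_distD y x z : enorm (x - z) <= enorm (x - y) + enorm (y - z).
Proof. by apply: le_trans (ler_enormD _ _); rewrite addrA subrK. Qed.

(** This links the two norms: local finiteness refers to the sup norm, flowers to Euclidean
    balls. *)
Lemma ler_norm_enorm x : `|x| <= enorm x.
Proof.
rewrite /Num.norm/= mx_normrE; apply/bigmax_leP; split; first exact: enorm_ge0.
by move=> -[i j] _ /=; rewrite (ord1 i); exact: enorm_coord.
Qed.

Lemma cball_bounded z r : bounded_set (cball z r).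
Proof.
exists (r + enorm z); split => [|s rs y yz]; first exact: num_real.
apply/(le_trans (ler_norm_enorm _))/(le_trans _ (ltW rs)).
apply: le_trans (_ : enorm (y - z) + enorm z <= _); last by rewrite lerD2r.
by have := ler_enormD (y - z) z; rewrite subrK.
Qed.

Lemma finite_cballI phi z r : locally_finite phi ->
  finite_set (phi `&` cball z r).
Proof. by move=> /(_ _ (cball_bounded z r)). Qed.

Lemma cball_meet z r c s y : cball z r y -> cball c s y -> enorm (z - c) <= r + s.
Proof.
move=> yz yc; apply: le_trans (ler_enorm_distD y z c) _.
by apply: lerD => //; rewrite enormB.
Qed.

(* The farthest point of the ball around [z] from [c] lies on the ray from [c]
   through [z]; when [z = c] any direction will do, and one exists as
   [0 < d]. *)
Lemma cball_subP z r c s : (0 < d)%N -> 0 <= r ->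
  cball z r `<=` cball c s <-> enorm (z - c) + r <= s.
Proof.
move=> d0 r0; split => [sub|zr y yz]; last first.
  apply: le_trans zr; rewrite [leRHS]addrC.
  apply: le_trans (ler_enorm_distD z y c) _; exact: lerD.
have [zc|zc] := eqVneq (enorm (z - c)) 0.
  pose e : point := delta_mx 0 (Ordinal d0).
  have e1 : enorm e = 1.
    rewrite /enorm (bigD1 (Ordinal d0))//= big1 => [|i i0].
      by rewrite !mxE !eqxx /= expr1n addr0 sqrtr1.
    by rewrite !mxE (negbTE i0) andbF expr0n.
  have : cball c s (z + r *: e).
    by apply: sub; rewrite /cball/= addrC addKr enormZ e1 mulr1 ger0_norm.
  move/enorm_eq0/subr0_eq : zc => <-.
  by rewrite subrr enorm0 add0r /cball/= addrC addKr enormZ e1 mulr1 ger0_norm.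
set a := enorm (z - c) in zc *.
have a0 : 0 < a by rewrite lt_def zc enorm_ge0.
have : cball c s (z + (r / a) *: (z - c)).
  apply: sub; rewrite /cball/= addrC addKr enormZ ger0_norm ?divr_ge0 ?enorm_ge0//.
  by rewrite divfK.
rewrite /cball/= addrAC -{1}[z - c]scale1r -scalerDl enormZ -/a.
by rewrite ger0_norm ?addr_ge0 ?divr_ge0 ?enorm_ge0// mulrDl mul1r divfK.
Qed.

(** Applied to the flower of an unmatched point, which is the whole space. In dimension 0 a single
    ball would cover it. *)
Lemma setT_not_sub_cball c s : (0 < d)%N -> ~ [set: point] `<=` cball c s.
Proof.
move=> d0 sub; have: cball c (`|s| + 1) `<=` cball c s by move=> y _; exact: sub.
rewrite (cball_subP _ _ _ d0) ?addr_ge0// subrr enorm0 add0r => h.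
by have := ler_norm s; lra.
Qed.

End EuclideanNorm.

(** * Preferences as translation invariant strict total orders *)

Section Preferences.
Context (R : realType) (d : nat).
Local Notation point := 'rV[R]_d.
Implicit Types (p q x y z : point).

Lemma lexltW x y : lexlt x y -> x <> y.
Proof. by move=> [i [_ +]] xy; rewrite xy ltxx. Qed.

Lemma lexlt_trans y x z : lexlt x y -> lexlt y z -> lexlt x z.
Proof.
move=> [i [xyE xy]] [j [yzE yz]]; have [ij|ji|/val_inj ij] := ltngtP i j.
- exists i; split => [k ki|]; first by rewrite xyE// yzE// (ltn_trans ki).
  by rewrite -yzE.
- exists j; split => [k kj|]; first by rewrite xyE ?yzE// (ltn_trans kj).
  by rewrite xyE.
- subst j; exists i; split => [k ki|]; first by rewrite xyE// yzE.
  exact: lt_trans yz.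
Qed.

Lemma lexlt_total x y : x <> y -> lexlt x y \/ lexlt y x.
Proof.
move=> xy; have [i0 i0P] : exists i, x 0 i != y 0 i.
  apply: contrapT => h; apply: xy; apply/rowP => i; apply: contrapT => /eqP xyi.
  by apply: h; exists i.
case: (@arg_minnP _ i0 (fun i => x 0 i != y 0 i) (@nat_of_ord d) i0P) => i xyi imin.
have eqlt (j : 'I_d) : (j < i)%N -> x 0 j = y 0 j.
  by move=> ji; apply/eqP; apply: contraTT ji => /imin; rewrite -leqNgt.
case/lt_total/orP : xyi => lt_i; [left|right]; exists i; split => // j ji.
by rewrite eqlt.
Qed.

Lemma lexlt_shift z x y : lexlt (x + z) (y + z) <-> lexlt x y.
Proof.
split=> -[i [eq_lt lt_i]]; exists i; split.
- by move=> j /eq_lt; rewrite !mxE => /addIr.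
- by move: lt_i; rewrite !mxE ltrD2r.
- by move=> j /eq_lt; rewrite !mxE => ->.
- by rewrite !mxE ltrD2r.
Qed.

Lemma prefers1_trans p y x z :
  prefers1 p x y -> prefers1 p y z -> prefers1 p x z.
Proof.
move=> [xy|[xy xyl]] [yz|[yz yzl]].
- by left; exact: lt_trans yz.
- by left; rewrite -yz.
- by left; rewrite xy.
- by right; split; [rewrite xy|exact: lexlt_trans yzl].
Qed.

Lemma prefers2_trans x q p s :
  prefers2 x p q -> prefers2 x q s -> prefers2 x p s.
Proof.
move=> [xy|[xy xyl]] [yz|[yz yzl]].
- by left; exact: lt_trans yz.
- by left; rewrite -yz.
- by left; rewrite xy.
- by right; split; [rewrite xy|exact: lexlt_trans xyl].
Qed.

Lemma prefers1_irr p x : ~ prefers1 p x x.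
Proof. by case=> [|[_ /lexltW]]; rewrite ?ltxx. Qed.

Lemma prefers2_irr x p : ~ prefers2 x p p.
Proof. by case=> [|[_ /lexltW]]; rewrite ?ltxx. Qed.

Lemma prefers1_total p x y : x <> y -> prefers1 p x y \/ prefers1 p y x.
Proof.
move=> /lexlt_total xy; have [lt|gt|eq] := ltgtP (enorm (x - p)) (enorm (y - p)).
- by left; left.
- by right; left.
- by case: xy => xy; [left|right]; right.
Qed.

Lemma prefers2_total x p q : p <> q -> prefers2 x p q \/ prefers2 x q p.
Proof.
move=> /lexlt_total xy; have [lt|gt|eq] := ltgtP (enorm (p - x)) (enorm (q - x)).
- by left; left.
- by right; left.
- by case: xy => xy; [right|left]; right.
Qed.

Lemma prefers1_cball p x y : prefers1 p x y -> cball p (enorm (y - p)) x.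
Proof. by case=> [/ltW//|[/eqP]]; rewrite eq_le => /andP[]. Qed.

Lemma prefers2_cball x p q : prefers2 x p q -> cball x (enorm (q - x)) p.
Proof. by case=> [/ltW//|[/eqP]]; rewrite eq_le => /andP[]. Qed.

Let subrDD z x y : (x + z) - (y + z) = x - y.
Proof. by rewrite opprD addrACA subrr addr0. Qed.

Lemma prefers1_shift z p x y :
  prefers1 (p + z) (x + z) (y + z) <-> prefers1 p x y.
Proof. by rewrite /prefers1 lexlt_shift !subrDD. Qed.

Lemma prefers2_shift z x p q :
  prefers2 (x + z) (p + z) (q + z) <-> prefers2 x p q.
Proof. by rewrite /prefers2 lexlt_shift !subrDD. Qed.

End Preferences.

(** * The mutual nearest neighbour matching *)

Section MatchingTheory.
Context (R : realType) (d : nat).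
Local Notation point := 'rV[R]_d.
Implicit Types (phi psi : set point) (p q x y z : point).

(** Keeping the step [n] visible provides the measure for the later inductions. *)
Definition matched_at phi psi n p x :=
  mutual (remaining phi psi n).1 (remaining phi psi n).2 p x.

Lemma remainingS1 phi psi n p : (remaining phi psi n.+1).1 p <->
  (remaining phi psi n).1 p /\ ~ exists x, matched_at phi psi n p x.
Proof. by rewrite /matched_at /=; case: remaining. Qed.

Lemma remainingS2 phi psi n x : (remaining phi psi n.+1).2 x <->
  (remaining phi psi n).2 x /\ ~ exists p, matched_at phi psi n p x.
Proof. by rewrite /matched_at /=; case: remaining. Qed.

Lemma remaining_anti phi psi m n : (m <= n)%N ->
  (remaining phi psi n).1 `<=` (remaining phi psi m).1 /\
  (remaining phi psi n).2 `<=` (remaining phi psi m).2.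
Proof.
elim: n => [|n IH]; first by rewrite leqn0 => /eqP ->; split.
rewrite leq_eqVlt => /orP[/eqP ->|/IH [IH1 IH2]]; first by split.
by split => y; rewrite ?remainingS1 ?remainingS2 => -[] /[swap] _; [exact: IH1|exact: IH2].
Qed.

Lemma matched_at_sub phi psi n p x : matched_at phi psi n p x -> phi p /\ psi x.
Proof.
have [s1 s2] := remaining_anti phi psi (leq0n n).
by case=> /s1 ? /s2 ? _ _.
Qed.

Lemma matched_atW phi psi n p x : matched_at phi psi n p x -> matched phi psi p x.
Proof. by exists n. Qed.

Lemma matched_sub phi psi p x : matched phi psi p x -> phi p /\ psi x.
Proof. by case=> n; exact: matched_at_sub. Qed.

Lemma matched_at_gone phi psi m n p x : matched_at phi psi m p x -> (m < n)%N ->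
  ~ (remaining phi psi n).1 p /\ ~ (remaining phi psi n).2 x.
Proof.
move=> mpx /(remaining_anti phi psi) [s1 s2].
by split => [/s1 /remainingS1|/s2 /remainingS2] [_]; apply; [exists x|exists p].
Qed.

Lemma goneP1 phi psi n p : phi p -> ~ (remaining phi psi n).1 p ->
  exists m x, (m < n)%N /\ matched_at phi psi m p x.
Proof.
move=> phip; elim: n => [//|n IH] h.
have [r|/IH [m [x [mn mpx]]]] := pselect ((remaining phi psi n).1 p); last first.
  by exists m, x; rewrite ltnW.
apply: contrapT => none; apply/h/remainingS1; split => // -[x nx].
by apply: none; exists n, x.
Qed.

Lemma goneP2 phi psi n x : psi x -> ~ (remaining phi psi n).2 x ->
  exists m p, (m < n)%N /\ matched_at phi psi m p x.
Proof.
move=> psix; elim: n => [//|n IH] h.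
have [r|/IH [m [p [mn mpx]]]] := pselect ((remaining phi psi n).2 x); last first.
  by exists m, p; rewrite ltnW.
apply: contrapT => none; apply/h/remainingS2; split => // -[p np].
by apply: none; exists n, p.
Qed.

(** At two different steps [p] would already be gone at the later one; at the same step [x] and [y]
    would each be preferred to the other. *)
Lemma matched_fun phi psi p x y :
  matched phi psi p x -> matched phi psi p y -> x = y.
Proof.
move=> [m mx] [n ny]; have [mn|nm|mn] := ltngtP m n.
- by have [+ _] := matched_at_gone mx mn; case: ny.
- by have [+ _] := matched_at_gone ny nm; case: mx.
- subst n; apply: contrapT => xy; case: mx ny => [_ px bx _] [_ py byy _].
  apply: (@prefers1_irr _ _ p x); apply: prefers1_trans (bx _ py _) (byy _ px _) => //.
  exact/nesym.
Qed.

Lemma matched_inj phi psi p q x :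
  matched phi psi p x -> matched phi psi q x -> p = q.
Proof.
move=> [m mx] [n ny]; have [mn|nm|mn] := ltngtP m n.
- by have [_ +] := matched_at_gone mx mn; case: ny.
- by have [_ +] := matched_at_gone ny nm; case: mx.
- subst n; apply: contrapT => pq; case: mx ny => [pp _ _ bp] [pq' _ _ bq].
  apply: (@prefers2_irr _ _ x p); apply: prefers2_trans (bp _ pq' _) (bq _ pp _) => //.
  exact/nesym.
Qed.

(** Since [p] settles for [x], the better [y] must have left before step [n]. When [y] left with
    [q], the point [p] was still available, so [y] preferred [q]. *)
Lemma matched_at_blocked1 phi psi n p x y :
  matched_at phi psi n p x -> psi y -> prefers1 p y x ->
  exists m q, [/\ (m < n)%N, matched_at phi psi m q y & prefers2 y q p].
Proof.
move=> mpx psiy pyx; have [rp rx best _] := mpx.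
have yx : y <> x by move=> yx; move: pyx; rewrite yx => /prefers1_irr.
have : ~ (remaining phi psi n).2 y.
  by move=> ry; have /(prefers1_trans pyx)/prefers1_irr := best _ ry yx.
move=> /(goneP2 psiy) [m [q [mn mqy]]]; exists m, q; split => //.
have [_ _ _ bq] := mqy; apply: bq; first exact: (remaining_anti phi psi (ltnW mn)).1.
by move=> pq; subst q; have [/(_ rp)] := matched_at_gone mqy mn.
Qed.

Lemma matched_at_blocked2 phi psi n p x q :
  matched_at phi psi n p x -> phi q -> prefers2 x q p ->
  exists m y, [/\ (m < n)%N, matched_at phi psi m q y & prefers1 q y x].
Proof.
move=> mpx phiq xqp; have [rp rx _ best] := mpx.
have qp : q <> p by move=> qp; move: xqp; rewrite qp => /prefers2_irr.
have : ~ (remaining phi psi n).1 q.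
  by move=> rq; have /(prefers2_trans xqp)/prefers2_irr := best _ rq qp.
move=> /(goneP1 phiq) [m [y [mn mqy]]]; exists m, y; split => //.
have [_ _ bq _] := mqy; apply: bq; first exact: (remaining_anti phi psi (ltnW mn)).2.
by move=> pq; subst y; have [_ /(_ rx)] := matched_at_gone mqy mn.
Qed.

Lemma finite_uniform_stage (T : choiceType) (A : set T) (Q : nat -> T -> Prop) :
  finite_set A -> (forall m n a, (m <= n)%N -> Q m a -> Q n a) ->
  (forall a, A a -> exists n, Q n a) -> exists n, forall a, A a -> Q n a.
Proof.
move=> Afin Qmono Aex.
(* One copy of [A] becomes the list on which the induction runs, while the other keeps the
   membership needed to apply [Aex]. *)
suff [n nP] : exists n, forall a, (A `&` A) a -> Q n a by exists n => a Aa; apply: nP.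
move/finite_seqP : Afin => [s sA]; rewrite {1}sA; elim: s {sA} => [|a s [n IH]].
  by exists 0%N => a [].
have [Aa|Aa] := pselect (A a); last first.
  by exists n => b [] /=; rewrite inE => /predU1P[-> //|bs Ab]; exact: IH.
have [m Qm] := Aex _ Aa; exists (maxn m n) => b [] /=.
rewrite inE => /predU1P[-> _|bs Ab]; first exact: Qmono (leq_maxl _ _) Qm.
by apply: Qmono (leq_maxr _ _) _; exact: IH.
Qed.

(* Converse of [matched_at_blocked1] and [matched_at_blocked2]: being matched is
   characterized recursively along decreasing edges. *)
Lemma matched_of_blocked phi psi p x :
  locally_finite phi -> locally_finite psi -> phi p -> psi x ->
  (forall y, psi y -> prefers1 p y x ->
    exists2 q, matched phi psi q y & prefers2 y q p) ->
  (forall q, phi q -> prefers2 x q p ->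
    exists2 y, matched phi psi q y & prefers1 q y x) ->
  matched phi psi p x.
Proof.
move=> phi_lf psi_lf phip psix block1 block2.
have [n1 gone1] : exists n, forall y, (psi y /\ prefers1 p y x) ->
    ~ (remaining phi psi n).2 y.
  apply: (@finite_uniform_stage _ [set y | psi y /\ prefers1 p y x]).
  - apply: sub_finite_set (finite_cballI p (enorm (x - p)) psi_lf).
    by move=> y [psiy /prefers1_cball].
  - by move=> m n y /(remaining_anti phi psi) [_ sub] h /sub.
  - move=> y [/block1 h /h [q [m mqy] _]]; exists m.+1.
    by have [] := matched_at_gone mqy (ltnSn m).
have [n2 gone2] : exists n, forall q, (phi q /\ prefers2 x q p) ->
    ~ (remaining phi psi n).1 q.
  apply: (@finite_uniform_stage _ [set q | phi q /\ prefers2 x q p]).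
  - apply: sub_finite_set (finite_cballI x (enorm (p - x)) phi_lf).
    by move=> y [phiy /prefers2_cball].
  - by move=> m n y /(remaining_anti phi psi) [sub _] h /sub.
  - move=> y [/block2 h /h [q [m mqy] _]]; exists m.+1.
    by have [] := matched_at_gone mqy (ltnSn m).
pose n := maxn n1 n2; apply: contrapT => unmatched.
(* Suppose [p] left with some [y] other than [x]. If [p] prefers [y], then [block1] gives [y] a
   partner better than [p], yet that partner is [p]. Otherwise [x] went to a better [q], and
   [block2] gives [q] a partner better than [x], yet that partner is [x]. *)
have rp : (remaining phi psi n).1 p.
  apply: contrapT => /(goneP1 phip) [m [y [_ mpy]]].
  have yx : y <> x by move=> yx; apply: unmatched; exists m; rewrite -yx.
  have [_ psiy] := matched_at_sub mpy.
  have [pyx|pxy] := prefers1_total p yx.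
    have [q mqy yqp] := block1 _ psiy pyx.
    have qp := matched_inj mqy (matched_atW mpy).
    by move: yqp; rewrite qp => /prefers2_irr.
  have [k [q [_ mqx xqp]]] := matched_at_blocked1 mpy psix pxy.
  have [y' mqy' qyx] := block2 _ (matched_at_sub mqx).1 xqp.
  have y'x := matched_fun mqy' (matched_atW mqx).
  by move: qyx; rewrite y'x => /prefers1_irr.
have rx : (remaining phi psi n).2 x.
  apply: contrapT => /(goneP2 psix) [m [q [_ mqx]]].
  have qp : q <> p by move=> qp; apply: unmatched; exists m; rewrite -qp.
  have [phiq _] := matched_at_sub mqx.
  have [xqp|xpq] := prefers2_total x qp.
    have [y mqy qyx] := block2 _ phiq xqp.
    have yx := matched_fun mqy (matched_atW mqx).
    by move: qyx; rewrite yx => /prefers1_irr.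
  have [k [y [_ mpy pyx]]] := matched_at_blocked2 mqx phip xpq.
  have [q' mqy' yqp] := block1 _ (matched_at_sub mpy).2 pyx.
  have q'p := matched_inj mqy' (matched_atW mpy).
  by move: yqp; rewrite q'p => /prefers2_irr.
(* Both points remain at step [n] and all their better alternatives are gone, so they are mutual
   nearest neighbours there. *)
apply: unmatched; exists n; split => // y ry yx.
- case: (prefers1_total p yx) => // pyx.
  have [_ s2] := remaining_anti phi psi (leq_maxl n1 n2 : (n1 <= n)%N).
  by have /gone1 := conj (proj2 (remaining_anti phi psi (leq0n n)) _ ry) pyx; case; apply: s2.
- case: (prefers2_total x yx) => // pyx.
  have [s1 _] := remaining_anti phi psi (leq_maxr n1 n2 : (n2 <= n)%N).
  by have /gone2 := conj (proj1 (remaining_anti phi psi (leq0n n)) _ ry) pyx; case; apply: s1.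
Qed.

Lemma matched_self phi psi z : phi z -> psi z -> matched phi psi z z.
Proof.
move=> phiz psiz; have pos y : y <> z -> 0 < enorm (y - z).
  by move=> yz; rewrite lt_def enorm_ge0 andbT; apply/eqP => /enorm_eq0/subr0_eq.
by exists 0%N; split => // y _ yz; left; rewrite subrr enorm0 pos.
Qed.

(** [tau] looks for a partner in both roles. If [z] is the second entry of a pair, it lies in both
    sets and is matched to itself, so injectivity makes that pair consist of [z] twice. *)
Lemma tauP phi psi z t : phi z -> tau phi psi z = Some t <-> matched phi psi z t.
Proof.
move=> phiz.
have partnerE y : matched phi psi z y \/ matched phi psi y z -> matched phi psi z y.
  move=> [//|myz]; have mzz := matched_self phiz (matched_sub myz).2.
  by rewrite -(matched_inj mzz myz).
rewrite /tau (asboolT (or_introl phiz)); case: asboolP => [[y yP]|none].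
  have := @xgetPex _ z [set y | matched phi psi z y \/ matched phi psi y z]
    (ex_intro _ _ yP).
  move=> /partnerE mz; split => [[<-//]|mzt]; congr Some.
  exact: matched_fun mz mzt.
by split => // mzt; exfalso; apply: none; exists t; left.
Qed.

Lemma tau_NoneP phi psi z : phi z ->
  tau phi psi z = None <-> ~ exists t, matched phi psi z t.
Proof.
move=> phiz; split => [tN [t /(tauP _ _ phiz)]|]; first by rewrite tN.
by case E: tau => [t|//] []; exists t; apply/tauP.
Qed.

Lemma matched_pointsP phi psi x :
  matched_points phi psi x <-> exists p, matched phi psi p x.
Proof.
rewrite /matched_points/=; split => [[psix]|[p mpx]]; last first.
  have [phip psix] := matched_sub mpx; split => //.
  by rewrite /tau (asboolT (or_intror psix)) asboolT//; exists p; right.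
rewrite /tau (asboolT (or_intror psix)); case: asboolP => // -[p [|]] mpx _.
  by exists x; apply: matched_self => //; have [] := matched_sub mpx.
by exists p.
Qed.

End MatchingTheory.

(** * Competing chains and locality of the matching *)

Section Flower.
Context (R : realType) (d : nat).
Local Notation point := 'rV[R]_d.
Implicit Types (phi psi A W : set point) (p q x y z : point).

Let update (c : nat -> point) k y : nat -> point :=
  fun i => if i == k then y else c i.

Lemma competing_chain_extend phi psi z k (c : nat -> point) y :
  competing_chain phi psi z k c ->
  (if odd k then psi y /\ prefers1 (c k) y (c k.-1)
   else phi y /\ prefers2 (c k) y (c k.-1)) ->
  competing_chain phi psi z k.+1 (update c k.+1 y).
Proof.
case=> -[k2 mem desc] c1 [t tz c2] yP; split.
- split; first exact: leqW.
  + move=> i /andP[i1 ik]; rewrite /update; case: eqVneq => [->/=|ik'].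
      by move: yP; case: (odd k) => -[].
    by apply: mem; rewrite i1 -ltnS ltn_neqAle ik'.
  + move=> i /andP[i2 ik] /=.
    have ik1 : (i == k.+1) = false by apply/eqP; move: ik => /=; lia.
    have ik2 : (i.-1 == k.+1) = false by apply/eqP; move: ik => /=; lia.
    rewrite /update ik1 ik2 eqSS; case: eqVneq => [->|ik'].
      by move: yP; case: (odd k) => -[].
    by apply: desc; rewrite i2 /=; move: ik ik' => /=; lia.
- by rewrite /update; case: eqP => [|_ //]; lia.
- by exists t => //; rewrite /update; case: eqP => [|_ //]; lia.
Qed.

(** The last vertex enters only as the choice of its predecessor, so transitivity keeps the chain
    descending. For [k = 2] that choice is instead compared with the partner [t]. *)
Lemma competing_chain_improve phi psi z k (c : nat -> point) y :
  competing_chain phi psi z k c ->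
  (if odd k then phi y /\ prefers2 (c k.-1) y (c k)
   else psi y /\ prefers1 (c k.-1) y (c k)) ->
  competing_chain phi psi z k (update c k y).
Proof.
case=> -[k2 mem desc] c1 [t tz c2] yP; split.
- split => //.
  + move=> i ik; rewrite /update; case: eqVneq => [->/=|_]; last exact: mem.
    by move: yP; case: (odd k) => -[].
  + move=> i ik; have := desc i ik.
    have ik1 : (i == k) = false by apply/eqP; move: ik; lia.
    have ik2 : (i.-1 == k) = false by apply/eqP; move: ik; lia.
    rewrite /update ik1 ik2; case: eqVneq => [kE|//].
    move: yP; rewrite -kE /=; case: (odd i) => /= -[_].
      exact: prefers1_trans.
    exact: prefers2_trans.
- by rewrite /update; case: eqP => [|_ //]; lia.
- exists t => //; rewrite /update; case: eqP => [kE|//]; right.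
  move: yP; rewrite -kE /= c1 => -[_ yc]; case: c2 => [<-//|].
  exact: prefers1_trans yc.
Qed.

(* Parity tells the roles of the two ends of the last edge apart, as a point may
   belong to both [phi] and [psi]. *)
Definition chain_edge phi psi z p x := exists k c,
  competing_chain phi psi z k c /\
  (if odd k then c k.-1 = x /\ c k = p else c k.-1 = p /\ c k = x).

Lemma chain_edge_start phi psi z t :
  matched phi psi z t -> chain_edge phi psi z z t.
Proof.
move=> mzt; have [phiz psit] := matched_sub mzt.
exists 2%N, (fun i => if i == 1%N then z else t); split => //; split => //.
- split => // i; last by lia.
  by case: i => [|[|[|i]]].
- by exists t; [apply/tauP|left].
Qed.

(** A chain that ends at [p] is extended by [y]; in a chain that ends at [x] the last point is
    replaced by [y]. *)
Lemma chain_edge_improve1 phi psi z p x y :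
  chain_edge phi psi z p x -> psi y -> prefers1 p y x -> chain_edge phi psi z p y.
Proof.
move=> [k [c [cc]]]; case: ifPn => ok [ck1 ck] psiy pyx.
  exists k.+1, (update c k.+1 y); rewrite /= ok; split.
    by apply: competing_chain_extend => //; rewrite ok ck ck1.
  by rewrite /update eqxx /= ltn_eqF.
exists k, (update c k y); rewrite (negbTE ok); split.
  by apply: competing_chain_improve => //; rewrite (negbTE ok) ck ck1.
by have [[k2 _ _] _ _] := cc; rewrite /update eqxx ltn_eqF//; lia.
Qed.

Lemma chain_edge_improve2 phi psi z p x q :
  chain_edge phi psi z p x -> phi q -> prefers2 x q p -> chain_edge phi psi z q x.
Proof.
move=> [k [c [cc]]]; case: ifPn => ok [ck1 ck] phiq xqp; last first.
  exists k.+1, (update c k.+1 q); rewrite /= ok; split.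
    by apply: competing_chain_extend => //; rewrite (negbTE ok) ck ck1.
  by rewrite /update eqxx /= ltn_eqF.
exists k, (update c k q); rewrite ok; split.
  by apply: competing_chain_improve => //; rewrite ok ck ck1.
by have [[k2 _ _] _ _] := cc; rewrite /update eqxx ltn_eqF//; lia.
Qed.

(** Either [x] is the centre of the last ball of the chain, or the last ball is centred at [p] and
    has [x] on its boundary. *)
Lemma chain_edge_flower phi psi z p x :
  chain_edge phi psi z p x -> flower phi psi z x.
Proof.
move=> [k [c [cc kP]]]; have [[k2 _ _] _ [t tz _]] := cc.
rewrite /flower tz; exists (k, c) => //; right; exists k => /=.
  by rewrite k2 leqnn.
rewrite /cball/=; move: kP; case: ifPn => _ [ck1 ck]; first by rewrite ck1 enormB.
by rewrite -{1}ck subrr enorm0 enorm_ge0.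
Qed.

(* Everything that blocks the competitors of an edge of a competing chain for
   [z] sits again on competing chains for [z], hence in the flower of [z]. *)
Lemma matched_local phi psi A z t :
  locally_finite phi -> locally_finite psi -> flower phi psi z `&` A = set0 ->
  matched phi psi z t -> matched phi (matched_points phi psi `&` ~` A) z t.
Proof.
move=> phi_lf psi_lf FA mzt; set psi' := _ `&` _.
have psi'_lf : locally_finite psi'.
  by apply: locally_finite_sub psi_lf => x [[]].
(* Strong induction on the step works because the pairs blocking the competitors were formed
   strictly earlier. *)
suff local n : forall p x, matched_at phi psi n p x -> chain_edge phi psi z p x ->
    matched phi psi' p x.
  by case: (mzt) => n /local; apply; exact: chain_edge_start.
elim/ltn_ind: n => n IH p x mpx edge; have [phip psix] := matched_at_sub mpx.
apply: matched_of_blocked => //.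
(* The point [x] survives the deletion: it is matched, and it lies in the flower, which misses
   [A]. *)
- split; first by apply/matched_pointsP; exists p; exists n.
  move=> Ax; have : (flower phi psi z `&` A) x by split => //; exact: chain_edge_flower edge.
  by rewrite FA.
- move=> y [[psiy _] _] pyx.
  have [m [q [mn mqy yqp]]] := matched_at_blocked1 mpx psiy pyx.
  exists q => //; apply: (IH _ mn _ _ mqy).
  apply: chain_edge_improve2 (matched_at_sub mqy).1 yqp.
  exact: chain_edge_improve1 pyx.
- move=> q phiq xqp.
  have [m [y [mn mqy qyx]]] := matched_at_blocked2 mpx phiq xqp.
  exists y => //; apply: (IH _ mn _ _ mqy).
  apply: chain_edge_improve1 (matched_at_sub mqy).2 qyx.
  exact: chain_edge_improve2 xqp.
Qed.

End Flower.

(** * Cardinality and the counting measure *)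

Lemma eq_counting (R : realType) (T U : choiceType) (A : set T) (B : set U) :
  (A #= B)%card -> counting A = counting B :> \bar R.
Proof.
move=> AB; rewrite /counting; have finE : finite_set A <-> finite_set B.
  by split => /finite_setP[n ?]; apply/finite_setP; exists n;
    [exact: card_eq_trans (card_esym AB) _|exact: card_eq_trans AB _].
case: asboolP => fA; case: asboolP => fB //; [|tauto|tauto].
have /finite_setP [n An] := fA.
by rewrite (card_fset_set An) (card_fset_set (card_eq_trans (card_esym AB) An)).
Qed.

Lemma counting_eq1P (R : realType) (T : choiceType) (A : set T) :
  counting A = 1%:E :> \bar R <-> exists x, A = [set x].
Proof.
rewrite /counting; split => [|[x ->]]; last first.
  by rewrite asboolT// fset_set1 finmap.cardfs1.
case: asboolP => // fA [] /eqP; rewrite pnatr_eq1 => /finmap.cardfs1P [x Ax].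
by exists x; rewrite -(fset_setK fA) Ax set_fset1.
Qed.

(** * Events written as predicates *)

Section MeasurablePredicates.
Context (disp : measure_display) (T : measurableType disp).
Implicit Types A B : T -> Prop.

(** With events as predicates, measurability follows the logical structure of definitions such as
    [mutual] and [prefers1]. *)
Definition mprop A := measurable [set w | A w].

Lemma mprop_ext A B : (forall w, A w <-> B w) -> mprop A -> mprop B.
Proof. by move=> AB; rewrite /mprop (_ : mkset A = mkset B)//; apply/seteqP; split=> w /AB. Qed.

Lemma mprop_const (C : Prop) : mprop (fun=> C).
Proof.
have [c|nc] := pselect C.
  by apply: mprop_ext (measurableT : mprop (fun=> True)) => w; split.
by apply: mprop_ext (measurable0 : mprop (fun=> False)) => w; split.
Qed.

Lemma mprop_not A : mprop A -> mprop (fun w => ~ A w).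
Proof. exact: measurableC. Qed.

Lemma mprop_and A B : mprop A -> mprop B -> mprop (fun w => A w /\ B w).
Proof. exact: measurableI. Qed.

Lemma mprop_or A B : mprop A -> mprop B -> mprop (fun w => A w \/ B w).
Proof. exact: measurableU. Qed.

Lemma mprop_imply A B : mprop A -> mprop B -> mprop (fun w => A w -> B w).
Proof.
move=> mA mB; apply: mprop_ext (mprop_or (mprop_not mA) mB) => w.
by split => [[nA /nA|]//|AB]; have [/AB|] := pselect (A w); [right|left].
Qed.

Lemma mprop_exists (I : countType) (A : I -> T -> Prop) :
  (forall i, mprop (A i)) -> mprop (fun w => exists i, A i w).
Proof.
move=> mA; rewrite /mprop (_ : mkset _ = \bigcup_i [set w | A i w]).
  by apply: countable_bigcupT_measurable.
by apply/seteqP; split => w [i]; [exists i|exists i].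
Qed.

Lemma mprop_forall (I : countType) (A : I -> T -> Prop) :
  (forall i, mprop (A i)) -> mprop (fun w => forall i, A i w).
Proof.
move=> mA; apply: mprop_ext (mprop_not (mprop_exists (fun i => mprop_not (mA i)))) => w.
by split => [h i|h [i]]; [apply: contrapT => nA; apply: h; exists i|apply].
Qed.

Lemma mprop_ltr (R : realType) (f g : T -> R) :
  measurable_fun [set: T] f -> measurable_fun [set: T] g ->
  mprop (fun w => f w < g w).
Proof.
move=> mf mg; have := measurable_fun_ltr mf mg measurableT (Y := [set true]) I.
by rewrite setTI.
Qed.

Lemma mprop_eqr (R : realType) (f g : T -> R) :
  measurable_fun [set: T] f -> measurable_fun [set: T] g ->
  mprop (fun w => f w = g w).
Proof.
move=> mf mg.
apply: mprop_ext (mprop_and (mprop_not (mprop_ltr mf mg)) (mprop_not (mprop_ltr mg mf))) => w.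
split => [[/negP + /negP]|->]; last by rewrite ltxx.
by rewrite -!leNgt => gf fg; apply/eqP; rewrite eq_le gf fg.
Qed.

End MeasurablePredicates.

(** * Random points and countable random sets *)

Section RandomSets.
Context (R : realType) (d : nat) (disp : measure_display) (T : measurableType disp).
Local Notation point := 'rV[R]_d.
Implicit Types (p q x y : T -> point) (S phi psi : T -> set point).

Definition rpoint p := forall B, borel B -> measurable (p @^-1` B).

Lemma rpoint_cst (z : point) : rpoint (fun=> z).
Proof.
move=> B _; have [Bz|Bz] := pselect (B z).
  by rewrite (_ : _ @^-1` _ = setT)//; apply/seteqP; split.
by rewrite (_ : _ @^-1` _ = set0)//; apply/seteqP; split.
Qed.

Lemma open_borel (U : set point) : open U -> borel U.
Proof. by move=> oU; apply: sub_sigma_algebra. Qed.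

Lemma borelI (U V : set point) : borel U -> borel V -> borel (U `&` V).
Proof.
move=> bU bV; have := @measurableI _ (g_sigma_algebraType [set W : set point | open W]) U V.
by rewrite /measurable/=; apply.
Qed.

Lemma measurable_coord p (i : 'I_d) : rpoint p -> measurable_fun [set: T] (fun w => p w 0 i).
Proof.
move=> rp; apply: (measurability _ (RGenOInfty.measurableE R)) => _ [_ [r ->] <-].
rewrite setTI (_ : _ @^-1` _ = p @^-1` [set z : point | r < z 0 i]); last first.
  by apply/seteqP; split => w /=; rewrite in_itv/= andbT.
apply: rp; apply: open_borel.
have := @open_comp _ _ (fun z : point => z 0 i) [set s | r < s].
by apply; [move=> z _; exact: coord_continuous|exact: open_gt].
Qed.

Lemma measurable_enormB p q : rpoint p -> rpoint q ->
  measurable_fun [set: T] (fun w => enorm (p w - q w)).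
Proof.
move=> rp rq; rewrite /enorm.
apply: (@measurableT_comp _ _ _ _ _ _ (@Num.sqrt R)).
  by apply: continuous_measurable_fun; exact: sqrt_continuous.
apply: measurable_sum => i; apply: measurable_funX.
have -> : (fun w => (p w - q w) 0 i) = (fun w => p w 0 i - q w 0 i).
  by apply/funext => w; rewrite !mxE.
by apply: measurable_funB; exact: measurable_coord.
Qed.

Lemma mprop_eq p q : rpoint p -> rpoint q -> mprop (fun w => p w = q w).
Proof.
move=> rp rq; have : mprop (fun w => forall i, p w 0 i = q w 0 i).
  by apply: mprop_forall => i; apply: mprop_eqr; exact: measurable_coord.
by apply: mprop_ext => w; split => [h|->//]; apply/rowP.
Qed.

Lemma mprop_lexlt p q : rpoint p -> rpoint q -> mprop (fun w => lexlt (p w) (q w)).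
Proof.
move=> rp rq; apply: mprop_exists => i; apply: mprop_and.
  apply: mprop_forall => j; apply: mprop_imply; first exact: mprop_const.
  by apply: mprop_eqr; exact: measurable_coord.
by apply: mprop_ltr; exact: measurable_coord.
Qed.

Lemma mprop_prefers1 p x y : rpoint p -> rpoint x -> rpoint y ->
  mprop (fun w => prefers1 (p w) (x w) (y w)).
Proof.
move=> rp rx ry; apply: mprop_or.
  by apply: mprop_ltr; exact: measurable_enormB.
apply: mprop_and; last exact: mprop_lexlt.
by apply: mprop_eqr; exact: measurable_enormB.
Qed.

Lemma mprop_prefers2 x p q : rpoint x -> rpoint p -> rpoint q ->
  mprop (fun w => prefers2 (x w) (p w) (q w)).
Proof.
move=> rp rx ry; apply: mprop_or.
  by apply: mprop_ltr; exact: measurable_enormB.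
apply: mprop_and; last exact: mprop_lexlt.
by apply: mprop_eqr; exact: measurable_enormB.
Qed.

(* A random set is presented by countably many random points, each of them
   present on a measurable event; quantification over its points then becomes
   countable. *)
Definition rset S := exists (f : nat -> T -> point) (e : nat -> T -> Prop),
  [/\ forall n, rpoint (f n), forall n, mprop (e n) &
      forall w z, S w z <-> exists n, e n w /\ z = f n w].

Lemma rset_ext S S' : (forall w z, S w z <-> S' w z) -> rset S -> rset S'.
Proof.
move=> SS' [f [e [rf me SE]]]; exists f, e; split => // w z.
by rewrite -SS' SE.
Qed.

(** Only the enumerated points have to be tried. Hence [Q] is tested along random points, and no
    joint measurability in the sample and the point is required. *)
Lemma mprop_exists_in S (Q : T -> point -> Prop) : rset S ->
  (forall p, rpoint p -> mprop (fun w => Q w (p w))) ->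
  mprop (fun w => exists z, S w z /\ Q w z).
Proof.
move=> [f [e [rf me SE]]] mQ.
have : mprop (fun w => exists n, e n w /\ Q w (f n w)).
  by apply: mprop_exists => n; apply: mprop_and => //; exact: mQ.
apply: mprop_ext => w; split => [[n [en Qn]]|[z [/SE[n [en ->]] Qz]]].
  by exists (f n w); split => //; apply/SE; exists n.
by exists n.
Qed.

Lemma mprop_forall_in S (Q : T -> point -> Prop) : rset S ->
  (forall p, rpoint p -> mprop (fun w => Q w (p w))) ->
  mprop (fun w => forall z, S w z -> Q w z).
Proof.
move=> rS mQ.
have := mprop_not (mprop_exists_in (Q := fun w z => ~ Q w z) rS
  (fun p rp => mprop_not (mQ p rp))).
apply: mprop_ext => w; split => [h z Sz|h [z [/h]]//].
by apply: contrapT => nQ; apply: h; exists z.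
Qed.

Lemma mprop_mem S p : rset S -> rpoint p -> mprop (fun w => S w (p w)).
Proof.
move=> rS rp; have := mprop_exists_in (Q := fun w z => p w = z) rS (fun q rq => mprop_eq rp rq).
by apply: mprop_ext => w; split => [[z [Sz ->]]//|Sp]; exists (p w).
Qed.

Lemma rset_filter S (Q : T -> point -> Prop) : rset S ->
  (forall p, rpoint p -> mprop (fun w => Q w (p w))) ->
  rset (fun w => [set z | S w z /\ Q w z]).
Proof.
move=> [f [e [rf me SE]]] mQ.
exists f, (fun n w => e n w /\ Q w (f n w)); split => //.
  by move=> n; apply: mprop_and => //; exact: mQ.
move=> w z; split => [[/SE[n [en ->]] Qz]|[n [[en Qn] ->]]]; first by exists n.
by split => //; apply/SE; exists n.
Qed.

Lemma rset_setIC S (B : set point) : rset S -> borel B -> rset (fun w => S w `&` B).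
Proof.
by move=> rS bB; apply: (rset_filter (Q := fun=> B)) => // p rp; exact: rp.
Qed.

Lemma measurable_counting S : rset S -> measurable_fun [set: T] (fun w => counting (S w) : \bar R).
Proof.
move=> [f [e [rf me SE]]].
(* The enumeration may repeat points. Keeping the first index of each turns the cardinality into a
   series of indicators. *)
pose new w := [set n | e n w /\ ~ exists m, (m < n)%N /\ e m w /\ f m w = f n w].
have countE w : counting (S w) = (\sum_(n <oo) \d_ n (new w))%E :> \bar R.
  rewrite -counting_dirac; have -> : S w = (f ^~ w) @` new w.
    apply/seteqP; split => [z /SE [n [en zE]]|_ [n [en _] <-]]; last first.
      by apply/SE; exists n.
    have ex : exists n, `[< e n w /\ z = f n w >] by exists n; apply/asboolP.
    case: (ex_minnP ex) => m /asboolP [em zm] mmin; exists m => //; split => //.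
    move=> [k [km [ek kE]]]; have : (m <= k)%N by apply/mmin/asboolP; rewrite kE.
    by rewrite leqNgt km.
  apply/eq_counting/inj_card_eq => m n /set_mem [em nm] /set_mem [en nn] mnE.
  by case: (ltngtP m n) => // lt_mn; exfalso; [apply: nn; exists m|apply: nm; exists n].
rewrite (_ : (fun w => _) =
    fun w => (\sum_(n <oo | n \in xpredT) \d_ n (new w))%E : \bar R); last first.
  by apply/funext => w; rewrite countE.
apply: ge0_emeasurable_sum => // n _.
rewrite (_ : (fun w => _) = EFin \o \1_[set w | new w n]); last first.
  apply/funext => w; rewrite /= /dirac /indic.
  by congr (_%:R%:E); apply/idP/idP => /set_mem h; apply/mem_set.
apply/measurable_EFinP/measurable_indic; apply: mprop_and; first exact: me.
apply/mprop_not/mprop_exists => m; apply: mprop_and; first exact: mprop_const.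
by apply: mprop_and => //; exact: mprop_eq.
Qed.

(** A chain is a function on all of [nat], and there are uncountably many choices of indices for it.
    As [Q] depends only on positions 1 to [n], finite lists of enumeration indices suffice, and
    these are countable. *)
Lemma mprop_exists_chain (S : nat -> T -> set point) n
    (Q : T -> (nat -> point) -> Prop) :
  (forall i, rset (S i)) ->
  (forall w c c', (forall i, (1 <= i <= n)%N -> c i = c' i) -> Q w c -> Q w c') ->
  (forall c : nat -> T -> point, (forall i, rpoint (c i)) ->
    mprop (fun w => Q w (c ^~ w))) ->
  mprop (fun w => exists c, (forall i, (1 <= i <= n)%N -> S i w (c i)) /\ Q w c).
Proof.
move=> /choice [f /choice [e fe]] Qext mQ.
have : mprop (fun w => exists s : seq nat,
    (forall i, (1 <= i <= n)%N -> e i (nth 0%N s i) w) /\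
    Q w (fun i => f i (nth 0%N s i) w)).
  apply: mprop_exists => s; apply: mprop_and.
    apply: mprop_forall => i; apply: mprop_imply; first exact: mprop_const.
    by have [_ + _] := fe i; apply.
  by apply: mQ => i; have [+ _ _] := fe i; apply.
apply: mprop_ext => w; split => [[s [es Qs]]|[c [Sc Qc]]].
  exists (fun i => f i (nth 0%N s i) w); split => // i /es ei.
  by have [_ _ ->] := fe i; exists (nth 0%N s i).
have /choice [k kP] i : exists k, (1 <= i <= n)%N -> e i k w /\ c i = f i k w.
  have [ik|_] := boolP (1 <= i <= n)%N; last by exists 0%N.
  by have := Sc _ ik; have [_ _ ->] := fe i; move=> [m ?]; exists m.
(* Position 0 is a dummy, so reaching position [n] takes a list of length [n.+1]. *)
have kE i : (1 <= i <= n)%N -> nth 0%N (mkseq k n.+1) i = k i.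
  by move=> /andP[_ ik]; rewrite nth_mkseq.
exists (mkseq k n.+1); split => [i ik|].
  by rewrite kE//; have [] := kP _ ik.
by apply: Qext Qc => i ik; rewrite kE//; have [] := kP _ ik.
Qed.

End RandomSets.

(** * The integer lattice *)

Section Lattice.
Context (R : realType) (d : nat).
Local Notation point := 'rV[R]_d.

Lemma ZdP (z : point) : Zd z <-> exists v : 'rV[int]_d, z = map_mx intr v.
Proof.
split => [Zz|[v ->] i]; last by rewrite mxE intr_int.
exists (\row_i Num.floor (z 0 i)); apply/rowP => i; rewrite !mxE.
by apply/esym/eqP; rewrite -intrEfloor; exact: Zz.
Qed.

Lemma Zd0 : Zd (0 : point). Proof. by move=> i; rewrite mxE rpred0. Qed.

Lemma ZdD (y z : point) : Zd y -> Zd z -> Zd (y + z).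
Proof. by move=> Zy Zz i; rewrite mxE rpredD. Qed.

Lemma ZdB (y z : point) : Zd y -> Zd z -> Zd (y - z).
Proof. by move=> Zy Zz i; rewrite !mxE rpredB. Qed.

Lemma Zd_locally_finite : locally_finite (Zd : set point).
Proof.
move=> B [M [_ BM]]; pose N := Num.bound `|M + 1|.
have BN z i : B z -> `|z 0 i| <= N%:R.
  move=> Bz; apply: le_trans (_ : `|z| <= _).
    by rewrite [leRHS]/Num.norm/= mx_normrE (le_bigmax _ _ (0, i)).
  apply: le_trans (BM (M + 1) _ _ Bz) _; first by rewrite ltrDl.
  by apply: le_trans (ler_norm _) (ltW (archi_boundP _)).
(* The coordinates are integers between [-N] and [N]; adding [N] encodes them in ['I_(N + N).+1]. *)
apply: (@sub_finite_set _ _ ((fun g : {ffun 'I_d -> 'I_(N + N).+1} =>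
  \row_i ((g i)%:R - N%:R : R)) @` setT)); last exact/finite_image/finite_finset.
move=> z [/ZdP [v zE] Bz].
exists [ffun i => inord (absz (v 0 i + N%:Z))] => //.
apply/rowP => i; rewrite mxE ffunE.
have := BN _ i Bz; rewrite zE mxE => viN.
have {}viN : (`|v 0 i| <= N%:Z)%R by rewrite -(ler_int R) intr_norm.
rewrite inordK; last by lia.
by rewrite natr_absz ger0_norm ?rmorphD /= ?addrK//; lia.
Qed.

End Lattice.

(** * Point processes as countable random sets *)

Section RandomLfset.
Context (R : realType) (d : nat) (disp : measure_display) (T : measurableType disp).
Local Notation point := 'rV[R]_d.
Implicit Types (S : T -> set point) (X : T -> lfset R d).

Lemma rset_countable (I : countType) (f : I -> T -> point) (e : I -> T -> Prop) :
  (forall i, rpoint (f i)) -> (forall i, mprop (e i)) ->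
  rset (fun w => [set z | exists i, e i w /\ z = f i w]).
Proof.
move=> rf me.
(* A number that codes no index gets the impossible event, so the default point 0 never enters the
   set. *)
exists (fun n w => if unpickle n is Some i then f i w else 0),
  (fun n w => if unpickle n is Some i then e i w else False); split.
- by move=> n; case: (unpickle n) => [i|]; [exact: rf|exact: rpoint_cst].
- by move=> n; case: (unpickle n) => [i|]; [exact: me|exact: mprop_const].
- move=> w z; split => [[i [ei ->]]|[n]]; first by exists (pickle i); rewrite pickleK.
  by case: (unpickle n) => [i [ei ->]|[]//]; exists i.
Qed.

Lemma rset_Zd : rset (fun _ : T => Zd : set point).
Proof.
have := @rset_countable 'rV[int]_d (fun v _ => map_mx intr v : point) (fun _ _ => True)
  (fun v => rpoint_cst _ _) (fun v => mprop_const _ True).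
apply: rset_ext => _ z; split => [[v [_ ->]]|/ZdP [v ->]]; last by exists v.
by apply/ZdP; exists v.
Qed.

Lemma measurable_lfcount X (B : set point) : borel B -> measurable_fun [set: T] X ->
  measurable_fun [set: T] (fun w => lfcount B (X w)).
Proof.
move=> bB mX; apply: (@measurableT_comp _ _ _ _ _ _ (lfcount B)) => // _ Y mY.
rewrite setTI; apply: sub_sigma_algebra; exists B => //; exists Y => //.
by rewrite setTI.
Qed.

Lemma measurable_fun_lfset X :
  (forall B, borel B -> measurable_fun [set: T] (fun w => lfcount B (X w))) ->
  measurable_fun [set: T] X.
Proof.
move=> mX; apply: (measurability _ (erefl (@lfset_measurable R d))).
move=> _ [_ [B bB [Y mY <-]] <-]; rewrite !setTI -comp_preimage.
by rewrite -[_ @^-1` _]setTI; exact: mX.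
Qed.

(** A countable family of sup-norm balls, fine enough to isolate every point of a locally finite
    set. *)
Let grid_ball (c : 'rV[int]_d * nat) : set point :=
  ball (c.2.+1%:R^-1 *: map_mx intr c.1 : point) (c.2.+1%:R^-1 : R).

Let grid_ball_borel c : borel (grid_ball c).
Proof. by apply: open_borel; exact: ball_open. Qed.

Let grid_ball_isolates (psi : set point) x : locally_finite psi -> psi x ->
  exists c, psi `&` grid_ball c = [set x].
Proof.
move=> psi_lf psix.
(* Two points of a ball of radius [1/(k+1)] are at distance less than [2/(k+1)], hence less than 2.
   So only the finitely many points within distance 2 of [x] have to be avoided. *)
have [k kP] : exists k : nat, forall y, (psi y /\ `|y - x| <= 2) ->
    y = x \/ 2 * k.+1%:R^-1 <= `|y - x|.
  apply: (@finite_uniform_stage _ [set y | psi y /\ `|y - x| <= 2]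
    (fun k y => y = x \/ 2 * k.+1%:R^-1 <= `|y - x|)).
  - apply: psi_lf; exists (2 + `|x|); split => [|r rx y /= yx]; first exact: num_real.
    apply: le_trans (ltW rx); rewrite -[y](subrK x).
    by apply: le_trans (ler_normD _ _) _; rewrite lerD2r.
  - move=> m n y mn [->|my]; [by left|right]; apply: le_trans my.
    by rewrite ler_pM2l// lef_pV2 ?posrE// ler_nat ltnS.
  - move=> y _; have [->|yx] := eqVneq y x; first by exists 0%N; left.
    have y0 : 0 < `|y - x| / 2 by rewrite divr_gt0// normr_gt0 subr_eq0.
    exists (Num.bound (`|y - x| / 2)^-1); right.
    rewrite mulrC -ler_pdivlMr// -[leRHS]invrK lef_pV2 ?posrE ?invr_gt0//.
    apply/ltW/(lt_trans (archi_boundP _)); first by rewrite invr_ge0 ltW.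
    by rewrite ltr_nat.
pose e : R := k.+1%:R^-1; have e0 : 0 < e by rewrite invr_gt0.
have e1 : e <= 1 by rewrite invf_le1// ler1n.
pose v : 'rV[int]_d := \row_i Num.floor (k.+1%:R * x 0 i).
have xv : grid_ball (v, k) x.
  rewrite /grid_ball/= -/e -ball_normE /= [ltLHS]/Num.norm/= mx_normrE.
  apply/bigmax_ltP; split => // -[i j] _ /=; rewrite (ord1 i) {i} !mxE.
  have -> : e * (Num.floor (k.+1%:R * x 0 j))%:~R - x 0 j =
      - (e * (k.+1%:R * x 0 j - (Num.floor (k.+1%:R * x 0 j))%:~R)).
    by rewrite mulrBr mulrA mulVf// mul1r opprB.
  rewrite normrN normrM gtr0_norm// -[ltRHS]mulr1 ltr_pM2l//.
  rewrite ger0_norm ?subr_ge0 ?ge_floor// ltrBlDr.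
  by have := lt_succ_floor (k.+1%:R * x 0 j); rewrite intrD [ltRHS]addrC.
exists (v, k); apply/seteqP; split => [y [psiy yv]|y ->//].
have yx : `|y - x| < 2 * e.
  move: xv yv; rewrite /grid_ball -!ball_normE/= -/e => xv yv.
  rewrite -(subrK (e *: map_mx intr v) y) -addrA.
  by apply: le_lt_trans (ler_normD _ _) _; rewrite mulrDl mul1r ltrD// distrC.
have yx2 : `|y - x| <= 2.
  by apply/ltW/(lt_le_trans yx); rewrite -[leRHS]mulr1 ler_pM2l.
by have [//|] := kP y (conj psiy yx2); rewrite leNgt yx.
Qed.

(** The counts of the grid balls are measurable, and the enumeration takes the unique point of each
    ball whose count is 1. By isolation every point of the configuration appears. *)
Lemma rset_lfset X : measurable_fun [set: T] X -> rset (fun w => pts (X w)).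
Proof.
move=> mX.
have count1 B : borel B -> mprop (fun w => lfcount B (X w) = 1%:E).
  move=> bB; have := measurable_lfcount bB mX measurableT (emeasurable_set1 1%:E).
  by rewrite setTI.
pose e c w := lfcount (grid_ball c) (X w) = 1%:E.
pose f c w : point := if `[< e c w >] then xget 0 (pts (X w) `&` grid_ball c) else 0.
have fE c w z : pts (X w) `&` grid_ball c = [set z] -> e c w /\ f c w = z.
  move=> Xz; have ec : e c w by apply/counting_eq1P; exists z.
  split => //; rewrite /f asboolT// Xz.
  by have := @xgetPex _ (0 : point) [set z] (ex_intro _ z erefl).
(* If the ball holds exactly one point, that point is in [B] exactly when the part of the ball
   inside [B] still has count 1; otherwise [f c] is the default 0. *)
have rf c : rpoint (f c).
  move=> B bB; have : mprop (fun w => e c w /\ lfcount (grid_ball c `&` B) (X w) = 1%:E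
    \/ ~ e c w /\ B 0).
    apply: mprop_or; first by apply: mprop_and; apply: count1 => //; exact: borelI.
    by apply: mprop_and; [apply/mprop_not/count1|exact: mprop_const].
  apply: mprop_ext => w; rewrite /preimage/=.
  have [ec|nec] := pselect (e c w); last first.
    by rewrite /f asboolF//; split => [[[/nec]|[]]//|B0]; right.
  have /counting_eq1P [z Xz] := ec; have [_ ->] := fE _ _ _ Xz.
  rewrite /lfcount setIA Xz; split => [[[_ /counting_eq1P [y zy]]|[]//]|Bz].
    by have [<-] : ([set z] `&` B) y by rewrite zy.
  by left; split => //; apply/counting_eq1P; exists z; apply/setIidl => _ ->.
have := rset_countable rf (fun c => count1 _ (grid_ball_borel c)).
apply: rset_ext => w z; split => [[c [/counting_eq1P [y Xy] ->]]|Xz].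
  have [_ ->] := fE _ _ _ Xy.
  by have [] : (pts (X w) `&` grid_ball c) y by rewrite Xy.
have [c /fE [ec <-]] := grid_ball_isolates (lfsetP (X w)) Xz.
by exists c.
Qed.

Lemma measurable_fun_rset_lfset X : rset (fun w => pts (X w)) -> measurable_fun [set: T] X.
Proof.
move=> rX; apply: measurable_fun_lfset => B bB.
exact/measurable_counting/rset_setIC.
Qed.

End RandomLfset.

(** * Measurability of the matching and of flower events *)

Section MeasurableMatching.
Context (R : realType) (d : nat) (disp : measure_display) (T : measurableType disp).
Local Notation point := 'rV[R]_d.
Variables phi psi : T -> set point.
Hypotheses (rphi : rset phi) (rpsi : rset psi).

Let mprop_mutual (phi' psi' : T -> set point) (p x : T -> point) :
  rset phi' -> rset psi' -> rpoint p -> rpoint x ->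
  mprop (fun w => mutual (phi' w) (psi' w) (p w) (x w)).
Proof.
move=> rphi' rpsi' rp rx.
have : mprop (fun w => phi' w (p w) /\ psi' w (x w) /\
    (forall y, psi' w y -> y <> x w -> prefers1 (p w) (x w) y) /\
    (forall q, phi' w q -> q <> p w -> prefers2 (x w) (p w) q)).
  apply: mprop_and; first exact: mprop_mem.
  apply: mprop_and; first exact: mprop_mem.
  apply: mprop_and.
    apply: (mprop_forall_in (Q := fun w y => y <> x w -> prefers1 (p w) (x w) y)) => // y ry.
    by apply: mprop_imply; [apply/mprop_not/mprop_eq|exact: mprop_prefers1].
  apply: (mprop_forall_in (Q := fun w q => q <> p w -> prefers2 (x w) (p w) q)) => // q rq.
  by apply: mprop_imply; [apply/mprop_not/mprop_eq|exact: mprop_prefers2].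
by apply: mprop_ext => w; split => [[? [? []]]|[? ? ? ?]].
Qed.

Let rset_remaining n :
  rset (fun w => (remaining (phi w) (psi w) n).1) /\
  rset (fun w => (remaining (phi w) (psi w) n).2).
Proof.
elim: n => [|n [r1 r2]]; first by split.
split.
- apply: (rset_ext _ (rset_filter
    (Q := fun w p => ~ exists x, matched_at (phi w) (psi w) n p x) r1 _)) => [w z|p rp].
    by rewrite remainingS1.
  apply: mprop_not; apply: mprop_ext (mprop_exists_in
    (Q := fun w x => matched_at (phi w) (psi w) n (p w) x) r2 _) => [w|x rx].
    by split => [[x []]|[x mpx]]; [exists x|exists x; split => //; case: mpx].
  exact: mprop_mutual.
- apply: (rset_ext _ (rset_filter
    (Q := fun w x => ~ exists p, matched_at (phi w) (psi w) n p x) r2 _)) => [w z|x rx].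
    by rewrite remainingS2.
  apply: mprop_not; apply: mprop_ext (mprop_exists_in
    (Q := fun w p => matched_at (phi w) (psi w) n p (x w)) r1 _) => [w|p rp].
    by split => [[p []]|[p mpx]]; [exists p|exists p; split => //; case: mpx].
  exact: mprop_mutual.
Qed.

Lemma mprop_matched (p x : T -> point) : rpoint p -> rpoint x ->
  mprop (fun w => matched (phi w) (psi w) (p w) (x w)).
Proof.
move=> rp rx; apply: mprop_exists => n; have [r1 r2] := rset_remaining n.
exact: mprop_mutual.
Qed.

Lemma rset_matched_points : rset (fun w => matched_points (phi w) (psi w)).
Proof.
apply: (rset_ext _ (rset_filter
  (Q := fun w x => exists p, phi w p /\ matched (phi w) (psi w) p x) rpsi _)) => [w x|x rx].
  rewrite matched_pointsP; split => [[_ [p []]]|[p mpx]]; first by exists p.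
  by have [phip psix] := matched_sub mpx; split => //; exists p.
apply: (mprop_exists_in (Q := fun w p => matched (phi w) (psi w) p (x w))) => // p rp.
exact: mprop_matched.
Qed.

Let far_chain (ctr : point) (s : R) (n : nat) (c : nat -> point) :=
  s < enorm (c 1%N - ctr) + enorm (c 1%N - c 2%N) \/
  exists i, (2 <= i <= n)%N /\ s < enorm (c i - ctr) + enorm (c i - c i.-1).

Let far_competing_chain (z0 ctr : point) s t n c :=
  (2 <= n)%N /\
  (forall i, (2 <= i <= n.-1)%N ->
    if odd i then prefers1 (c i) (c i.+1) (c i.-1)
    else prefers2 (c i) (c i.+1) (c i.-1)) /\
  c 1%N = z0 /\ (c 2%N = t \/ prefers1 z0 (c 2%N) t) /\ far_chain ctr s n c.

(** This leaves only quantifiers over points of [phi] and [psi] and over finite chains. Failure of a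
    ball inclusion becomes a strict inequality by [cball_subP], and the unmatched case, with the
    whole space as flower, is the first alternative. *)
Let flower_not_subP w z0 ctr s : (0 < d)%N -> phi w z0 ->
  ~ (flower (phi w) (psi w) z0 `<=` cball ctr s) <->
  (~ exists t, psi w t /\ matched (phi w) (psi w) z0 t) \/
  (exists t, psi w t /\ (matched (phi w) (psi w) z0 t /\
    exists n c,
      (forall i, (1 <= i <= n)%N -> (if odd i then phi w else psi w) (c i)) /\
      far_competing_chain z0 ctr s t n c)).
Proof.
move=> d0 phiz; rewrite /flower; case E: tau => [t|]; last first.
  split => [_|_]; last exact: setT_not_sub_cball.
  left => -[t [_ mzt]].
  by apply: (proj1 (tau_NoneP (psi w) phiz) E); exists t.
have mzt : matched (phi w) (psi w) z0 t by apply/tauP.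
split => [nsub|[none|[t' [_ [mzt' [n [c [mem [n2 [desc [c1 [c2 far]]]]]]]]]]] sub].
- right; exists t; split; first by have [] := matched_sub mzt.
  split => //; apply: contrapT => none; apply: nsub => y [[n c]] /=.
  move=> [[n2 mem desc] c1 [t' + c2]]; rewrite E => -[tt']; subst t'.
  move=> creg; apply: contrapT => ny; apply: none; exists n, c; split.
    by move=> i /mem; case: (odd i).
  do 4![split => //]; case: creg => [y1|[i /= iP yi]]; [left|right].
    rewrite ltNge; apply/negP => /(cball_subP _ _ _ d0 (enorm_ge0 _)) sub.
    by apply: ny; exact: sub.
  exists i; split => //.
  rewrite ltNge; apply/negP => /(cball_subP _ _ _ d0 (enorm_ge0 _)) sub.
  by apply: ny; exact: sub.
- by apply: none; exists t; split => //; have [] := matched_sub mzt.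
- have tt' := matched_fun mzt mzt'; subst t'.
  have {}sub : chain_region n c `<=` cball ctr s.
    apply: subset_trans sub => y yc; exists (n, c) => //; split => //.
      by split => // i /mem; case: (odd i).
    by exists t.
  case: far => [|[i [iP]]]; rewrite ltNge => /negP; apply.
    by apply/(cball_subP _ _ _ d0 (enorm_ge0 _)); apply: subset_trans sub => y; left.
  apply/(cball_subP _ _ _ d0 (enorm_ge0 _)); apply: subset_trans sub => y yi.
  by right; exists i.
Qed.

(* Measurability is essential here: the library leaves the value of a measure on
   a non-measurable set unspecified (but nonnegative), so a summability
   hypothesis about such sets would be void. *)
Lemma mprop_flower_not_sub (z0 ctr : point) (s : R) : (0 < d)%N ->
  (forall w, phi w z0) ->
  mprop (fun w => ~ (flower (phi w) (psi w) z0 `<=` cball ctr s)).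
Proof.
move=> d0 phiz; apply: mprop_ext (fun w => iff_sym (flower_not_subP _ _ d0 (phiz w))) _.
have rz := rpoint_cst T z0; have rctr := rpoint_cst T ctr.
apply: mprop_or.
  apply: mprop_not.
  apply: (mprop_exists_in (Q := fun w t => matched (phi w) (psi w) z0 t)) => // t rt.
  exact: (mprop_matched rz rt).
apply: (mprop_exists_in (Q := fun w t => matched (phi w) (psi w) z0 t /\
    exists n c, (forall i, (1 <= i <= n)%N -> (if odd i then phi w else psi w) (c i)) /\
      far_competing_chain z0 ctr s t n c)) => // t rt.
apply: mprop_and; first exact: (mprop_matched rz rt).
apply: mprop_exists => n.
apply: (mprop_exists_chain (S := fun i w => if odd i then phi w else psi w)
  (Q := fun w c => far_competing_chain z0 ctr s (t w) n c)).
- by move=> i; case: (odd i).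
- move=> w c c' cc' [n2 [desc [c1 [c2 far]]]].
  have c'1 : c' 1%N = c 1%N by rewrite cc'//; lia.
  have c'2 : c' 2%N = c 2%N by rewrite cc'//; lia.
  rewrite /far_competing_chain /far_chain c'1 c'2; split => //; split.
    by move=> i iP; move: (desc i iP); rewrite !cc'//; move: iP; lia.
  split => //; split => //; case: far => [|[i [iP far]]]; [by left|right].
  by exists i; split => //; rewrite -!cc'//; move: iP; lia.
- move=> c rc; apply: mprop_and; first exact: mprop_const.
  apply: mprop_and.
    apply: mprop_forall => i; apply: mprop_imply; first exact: mprop_const.
    by case: (odd i); [exact: mprop_prefers1|exact: mprop_prefers2].
  apply: mprop_and; first exact: mprop_eq.
  apply: mprop_and.
    by apply: mprop_or; [exact: mprop_eq|exact: mprop_prefers1].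
  have far_meas i j : mprop (fun w => s < enorm (c i w - ctr) + enorm (c i w - c j w)).
    apply: mprop_ltr; first exact: measurable_cst.
    by apply: measurable_funD; exact: measurable_enormB.
  apply: mprop_or; first exact: far_meas.
  apply: mprop_exists => i; apply: mprop_and; first exact: mprop_const.
  exact: far_meas.
Qed.

End MeasurableMatching.

(** * Translation covariance of the matching and the flower *)

Section Shift.
Context (R : realType) (d : nat).
Local Notation point := 'rV[R]_d.
Implicit Types (phi psi : set point) (p q x y z : point).

(** The hypotheses are pointwise equivalences so that the lemma also applies to the sets remaining
    after each step. *)
Let mutual_shift z phi psi phi' psi' :
  (forall p, phi' p <-> phi (p + z)) -> (forall x, psi' x <-> psi (x + z)) ->
  forall p x, mutual phi' psi' p x <-> mutual phi psi (p + z) (x + z).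
Proof.
move=> phiE psiE p x; split => -[/phiE phip /psiE psix bx bp]; split => //.
- move=> y psiy yx; rewrite -(subrK z y); apply/prefers1_shift/bx.
    by apply/psiE; rewrite subrK.
  by move=> yxE; apply: yx; rewrite -yxE subrK.
- move=> q phiq qp; rewrite -(subrK z q); apply/prefers2_shift/bp.
    by apply/phiE; rewrite subrK.
  by move=> qpE; apply: qp; rewrite -qpE subrK.
- by move=> y /psiE psiy yx; apply/(prefers1_shift z)/bx => // /addIr.
- by move=> q /phiE phiq qp; apply/(prefers2_shift z)/bp => // /addIr.
Qed.

Section FixedSets.
Variables (z : point) (phi psi phi' psi' : set point).
Hypothesis phiE : forall p, phi' p <-> phi (p + z).
Hypothesis psiE : forall x, psi' x <-> psi (x + z).

Let remaining_shift n :
  (forall p, (remaining phi' psi' n).1 p <-> (remaining phi psi n).1 (p + z)) /\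
  (forall x, (remaining phi' psi' n).2 x <-> (remaining phi psi n).2 (x + z)).
Proof.
elim: n => [|n [IH1 IH2]]; first by split.
have matched_atE := mutual_shift IH1 IH2.
split => [p|x]; rewrite ?remainingS1 ?remainingS2.
- split => -[/IH1 rp np]; split => // -[x mpx]; apply: np.
    by exists (x - z); apply/matched_atE; rewrite subrK.
  by exists (x + z); apply/matched_atE.
- split => -[/IH2 rp np]; split => // -[p mpx]; apply: np.
    by exists (p - z); apply/matched_atE; rewrite subrK.
  by exists (p + z); apply/matched_atE.
Qed.

Lemma matched_shift p x :
  matched phi' psi' p x <-> matched phi psi (p + z) (x + z).
Proof.
by split => -[n mpx]; exists n; have [IH1 IH2] := remaining_shift n;
  apply/(mutual_shift IH1 IH2).
Qed.

Lemma flower_shift p y : phi' p -> flower phi' psi' p y ->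
  flower phi psi (p + z) (y + z).
Proof.
move=> phi'p; have phip : phi (p + z) by apply/phiE.
rewrite /flower; case E': (tau phi' psi' p) => [t|]; last first.
  suff -> : tau phi psi (p + z) = None by [].
  apply/(tau_NoneP _ phip) => -[t mt]; apply: (proj1 (tau_NoneP psi' phi'p) E').
  by exists (t - z); apply/matched_shift; rewrite subrK.
have E : tau phi psi (p + z) = Some (t + z).
  by apply/(tauP _ _ phip)/matched_shift/(tauP _ _ phi'p).
rewrite E => -[[n c] /= [[n2 mem desc] c1 [t' + c2]]].
rewrite E' => -[tt']; subst t'; move=> creg.
have distE x x' : enorm (x + z - (x' + z)) = enorm (x - x').
  by rewrite opprD addrACA subrr addr0.
exists (n, fun i => c i + z) => /=.
  split; [split => //| by rewrite c1|].
  - by move=> i /mem; case: (odd i) => [/phiE|/psiE].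
  - by move=> i /desc; case: (odd i) => [/prefers1_shift|/prefers2_shift]; apply.
  - exists (t + z) => //; case: c2 => [->|c2]; first by left.
    by right; apply/prefers1_shift.
case: creg => [y1|[i iP yi]]; [left|right].
  by rewrite /cball/= !distE.
by exists i => //; rewrite /cball/= !distE.
Qed.

End FixedSets.

(** For a lattice vector [z] the lattice is its own translate, so only [psi] has to move. The two
    directions use [flower_shift] with [z] and [- z]. *)
Lemma flower_lfshift (psi : lfset R d) z s : Zd z ->
  flower Zd psi z `<=` cball z s <->
  flower Zd (lfshift (- z) psi) 0 `<=` cball 0 s.
Proof.
move=> Zz.
have phiE p : Zd p <-> Zd (p + z).
  by split => [Zp|/ZdB/(_ Zz)]; [exact: ZdD|rewrite addrK].
have phiE' p : Zd p <-> Zd (p - z).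
  by split => [Zp|/ZdD/(_ Zz)]; [exact: ZdB|rewrite subrK].
have psiE x : pts (lfshift (- z) psi) x <-> pts psi (x + z).
  split => [[y psiy <-]|psix]; first by rewrite subrK.
  by exists (x + z) => //; rewrite addrK.
have psiE' x : pts psi x <-> pts (lfshift (- z) psi) (x - z).
  by rewrite psiE subrK.
have cballE y : cball z s y <-> cball 0 s (y - z) by rewrite /cball/= subr0.
split => sub y.
  move=> /(flower_shift phiE psiE (@Zd0 R d)); rewrite add0r => /sub /cballE.
  by rewrite addrK.
by move=> /(flower_shift phiE' psiE' Zz); rewrite subrr => /sub /cballE.
Qed.

End Shift.

(** * Counting matched points through finitely many lattice points *)

Lemma counting_setD (R : realType) (T : choiceType) (A B : set T) :
  finite_set A -> B `<=` A ->
  counting (A `\` B) = (counting A - counting B)%E :> \bar R.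
Proof.
move=> fA BA; have fB := sub_finite_set BA fA; have fAB := finite_setD B fA.
have sBA : finmap.fsubset (fset_set B) (fset_set A) by rewrite -fset_set_sub.
rewrite /counting !asboolT// -EFinB; congr EFin.
by rewrite fset_setD// finmap.cardfsDS// natrB// finmap.fsubset_leq_card.
Qed.

Section Counting.
Context (R : realType) (d : nat).
Local Notation point := 'rV[R]_d.
Variables (phi psi A W : set point).
Hypotheses (phi_lf : locally_finite phi) (psi_lf : locally_finite psi).
Hypothesis phi_matched : forall z, phi z -> exists t, matched phi psi z t.
Hypotheses (Wphi : W `<=` phi) (W_finite : finite_set W).
Hypothesis flower_disj :
  forall z, phi z -> ~ W z -> flower phi psi z `&` A = set0.

Let psi' := matched_points phi psi `&` ~` A.

(** The partner map [f] is injective on [W]. Its image consists of the matched points in [A], whose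
    partners lie in [W] because a flower contains the partner, and of the set [S] outside [A]. *)
Lemma counting_matched_points :
  counting (matched_points phi psi `&` A) =
  (counting W - counting [set x | psi' x /\
     ~ exists z, (phi z /\ ~ W z) /\ matched phi psi' z x])%E :> \bar R.
Proof.
set S := [set x | _].
have /choice [f fP] z : exists t, W z -> matched phi psi z t.
  have [Wz|nWz] := pselect (W z); last by exists 0.
  by have [t mzt] := phi_matched (Wphi Wz); exists t.
have local z t : phi z -> ~ W z -> matched phi psi z t -> matched phi psi' z t.
  by move=> phiz nWz; apply: matched_local => //; exact: flower_disj.
have SfW : S `<=` f @` W.
  move=> x [[/matched_pointsP [p mpx] nAx] none].
  have [phip _] := matched_sub mpx.
  have [Wp|nWp] := pselect (W p).
    by exists p => //; exact: matched_fun (fP _ Wp) mpx.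
  by exfalso; apply: none; exists p; split => //; exact: local.
have -> : matched_points phi psi `&` A = (f @` W) `\` S.
  apply/seteqP; split => [x [Mx Ax]|_ [[z Wz <-] nS]].
    split; last by case=> -[].
    have [p mpx] := (matched_pointsP _ _ _).1 Mx.
    have [Wp|nWp] := pselect (W p); first by exists p => //; exact: matched_fun (fP _ Wp) mpx.
    have : (flower phi psi p `&` A) x.
      by split => //; exact/chain_edge_flower/chain_edge_start.
    by rewrite flower_disj//; have [] := matched_sub mpx.
  have mzf := fP _ Wz; have Mf : matched_points phi psi (f z).
    by apply/matched_pointsP; exists z.
  (* If [z'] outside [W] claims [f z] in the matching with [psi'], locality shows that [f z] is also
     its partner in the full matching. Then [z' = z], which is in [W]. *)
  split => //; apply: contrapT => nA; apply: nS; split => // -[z' [[phiz' nWz'] mz']].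
  have [t mt] := phi_matched phiz'.
  have tE := matched_fun (local _ _ phiz' nWz' mt) mz'; rewrite tE in mt.
  by apply: nWz'; rewrite (matched_inj mt mzf).
rewrite counting_setD//; last exact: finite_image.
congr (_ - _)%E; apply/eq_counting/inj_card_eq => z z' /set_mem Wz /set_mem Wz' zz'.
by apply: matched_inj (fP _ Wz) _; rewrite zz'; exact: fP.
Qed.

End Counting.

(** * Almost sure statements and Borel-Cantelli *)

Lemma ae_forall_countType (disp : measure_display) (T : measurableType disp)
    (R : realType) (mu : {measure set T -> \bar R}) (I : countType)
    (Q : I -> T -> Prop) :
  (forall i, {ae mu, forall w, Q i w}) -> {ae mu, forall w, forall i, Q i w}.
Proof.
move=> aeQ.
have : {ae mu, forall w, forall n, if unpickle n is Some i then Q i w else True}.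
  apply: ae_foralln => n; case: (unpickle n) => [i|]; first exact: aeQ.
  exact: filterE.
by apply: filterS => w h i; have := h (pickle i); rewrite pickleK.
Qed.

Lemma borel_cantelli_esum (disp : measure_display) (T : measurableType disp)
    (R : realType) (mu : {measure set T -> \bar R}) (U : pointedType)
    (D : set U) (E : U -> set T) :
  countable D -> infinite_set D -> (forall u, D u -> measurable (E u)) ->
  (\esum_(u in D) mu (E u) < +oo)%E ->
  {ae mu, forall w, finite_set [set u | D u /\ E u w]}.
Proof.
move=> cD iD mE sumE.
have /card_set_bijP [e eD] : ([set: nat] #= D)%card by apply/card_esym/eq_card_nat.
have De n : D (e n) by have [+ _ _] := eD; apply.
have mF n : measurable (E (e n)) by exact: mE.
(* The bijection [e] turns the sum over [D] into a series, so the upper limit of the events is null.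
   Off that set all occurring events have index below some [n]. *)
exists (lim_sup_set (E \o e)); split.
- by apply: bigcap_measurable => // n _; apply: bigcup_measurable => k _; exact: mF.
- apply: lim_sup_set_cvg0 => //=; rewrite nneseries_esumT//=.
  by rewrite -(reindex_esum [set: nat] D e (fun u => mu (E u))).
- move=> w /= infw n _; apply: contrapT => none; apply: infw.
  apply: (@sub_finite_set _ _ (e @` `I_n)); last exact/finite_image/finite_II.
  move=> u [Du Eu]; have [_ _ /(_ _ Du) [k _ ku]] := eD; exists k => //=.
  rewrite ltnNge; apply/negP => nk; apply: none; exists k => //=.
  by rewrite ku.
Qed.

(** * Exhausting and halving the lattice; finitely many flowers meet a ball *)

Section LatticeCounting.
Context (R : realType) (d : nat).
Local Notation point := 'rV[R]_d.

Lemma ler_enorm (x y : point) : (forall i, `|x 0 i| <= `|y 0 i|) -> enorm x <= enorm y.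
Proof.
move=> xy; apply/ler_wsqrtr/ler_sum => i _.
by rewrite -real_normK ?num_real// -[leRHS]real_normK ?num_real// lerXn2r ?nnegrE.
Qed.

Lemma countable_Zd : countable (Zd : set point).
Proof.
have -> : (Zd : set point) = (fun v : 'rV[int]_d => map_mx intr v) @` setT.
  by apply/seteqP; split => [z /ZdP [v ->]|_ [v _ <-]]; [exists v|apply/ZdP; exists v].
exact/(sub_countable (card_image_le _ _))/countableP.
Qed.

Lemma infinite_Zd : (0 < d)%N -> infinite_set (Zd : set point).
Proof.
move=> d0 Zfin; apply: infinite_nat.
have := @finite_preimage _ _ Zd (fun n => n%:R *: const_mx 1 : point).
rewrite (_ : _ @^-1` _ = setT); last first.
  by apply/seteqP; split => // n _ i; rewrite !mxE mulr1 rpred_nat.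
apply => // m n _ _ /rowP/(_ (Ordinal d0)); rewrite !mxE !mulr1.
by move/eqP; rewrite eqr_nat => /eqP.
Qed.

Definition Zd_initial n : set point :=
  [set z | exists v : 'rV[int]_d, (pickle v < n)%N /\ z = map_mx intr v].

Lemma Zd_initial_sub n : Zd_initial n `<=` Zd.
Proof. by move=> z [v [_ ->]]; apply/ZdP; exists v. Qed.

Lemma finite_Zd_initial n : finite_set (Zd_initial n).
Proof.
apply: (@sub_finite_set _ _ ((fun v : 'rV[int]_d => map_mx intr v) @`
  (pickle @^-1` `I_n))); first by move=> z [v [vn ->]]; exists v.
apply/finite_image/finite_preimage; last exact: finite_II.
by move=> u v _ _; apply: (pcan_inj pickleK).
Qed.

Lemma Zd_initial_exhaust (B : set point) : finite_set B -> B `<=` Zd ->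
  exists N, forall n, (N <= n)%N -> B `<=` Zd_initial n.
Proof.
move=> Bfin BZ.
have [N NP] : exists n, forall z, B z -> Zd_initial n z.
  apply: finite_uniform_stage => // [m n z mn [v [vm ->]]|z /BZ/ZdP [v ->]].
    by exists v; split => //; exact: leq_trans mn.
  by exists (pickle v).+1, v.
exists N => n Nn z /NP [v [vN ->]]; exists v; split => //; exact: leq_trans Nn.
Qed.

Lemma Zd_half (z : point) : Zd z -> exists u v : 'rV[int]_d,
  [/\ z = 2 *: map_mx intr u + map_mx intr v,
      enorm (2 *: map_mx intr u : point) <= enorm z &
      enorm (map_mx intr v : point) <= enorm (const_mx 1 : point)].
Proof.
move=> /ZdP [m ->].
(* Rounding is towards zero: rounding down would give -2 for -3, and the double -4 would exceed it
   in absolute value. *)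
pose half (k : int) : int := (if 0 <= k then (k %/ 2)%Z else - ((- k) %/ 2)%Z).
have half_le k : `|2 * half k| <= `|k| by rewrite /half; case: ifPn; lia.
have half_rem k : `|k - 2 * half k| <= 1 by rewrite /half; case: ifPn; lia.
exists (\row_i half (m 0 i)), (\row_i (m 0 i - 2 * half (m 0 i))); split.
- by apply/rowP => i; rewrite !mxE rmorphB rmorphM /= addrC subrK.
- apply: ler_enorm => i; rewrite !mxE -[2](_ : 2%:~R = _)// -intrM -!intr_norm.
  by rewrite ler_int.
- by apply: ler_enorm => i; rewrite !mxE normr1 -intr_norm (ler_int _ _ 1).
Qed.

(** Write [z = 2u + v] as in [Zd_half]. If the flower stays in the ball of radius [|u|] about [z]
    and meets the ball of radius [r] about 0, then [|z| <= |u| + r <= |z|/2 + r], so [|z| <= 2r].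
    Every other [z] comes from an exceptional [u] for one of finitely many [v]. *)
Lemma finite_flower_meet (psi : set point) (r : R) :
  (forall v : 'rV[int]_d, finite_set [set u : point | Zd u /\
     ~ flower Zd psi (2 *: u + map_mx intr v) `<=`
       cball (2 *: u + map_mx intr v) (enorm u)]) ->
  finite_set [set z | Zd z /\ flower Zd psi z `&` cball 0 r <> set0].
Proof.
move=> far.
pose bad (y : point) : set point := [set u : point | Zd u /\
     ~ flower Zd psi (2 *: u + y) `<=` cball (2 *: u + y) (enorm u)].
pose V : set point := Zd `&` cball 0 (enorm (const_mx 1 : point)).
have Vfin : finite_set V by apply: finite_cballI; exact: Zd_locally_finite.
apply: (@sub_finite_set _ _ ((Zd `&` cball 0 (2 * r)) `|`
    \bigcup_(y in V) (fun u => 2 *: u + y) @` bad y)); last first.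
  rewrite finite_setU; split; first by apply: finite_cballI; exact: Zd_locally_finite.
  apply: bigcup_finite => // y [/ZdP [v ->] _]; exact/finite_image/far.
move=> z [Zz meet]; have [zr|zr] := leP (enorm z) (2 * r).
  by left; split => //; rewrite /cball/= subr0.
right; have [u [v [zE uz vV]]] := Zd_half Zz.
exists (map_mx intr v); first by split; [apply/ZdP; exists v|rewrite /cball/= subr0].
exists (map_mx intr u); last exact/esym.
split; first by apply/ZdP; exists u.
rewrite -zE => sub; apply: meet; apply/seteqP; split => // y [/sub yz y0].
have := cball_meet yz y0; rewrite subr0 => zur.
move: uz; rewrite enormZ ger0_norm// => uz.
by move: zr; rewrite ltNge => /negP; apply; lra.
Qed.

End LatticeCounting.

(** * Recovering the hidden number from the outside configuration *)

Section Recovery.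
Context (R : realType) (d : nat).
Local Notation N := (lfset R d).

(** The matching is run anew on [phi] alone, so the set can be evaluated on the configuration
    outside a ball. *)
Definition unclaimed n (phi : N) : set 'rV[R]_d :=
  [set x | pts phi x /\
    ~ exists z, (Zd z /\ ~ Zd_initial n z) /\ matched Zd (pts phi) z x].

(** The sequence is eventually constant under the hypotheses of [recovered_countE]. The upper limit
    is measurable and avoids a choice of [n] depending on the configuration. *)
Definition recovered_count (phi : N) : \bar R :=
  limn_esup (fun n => counting (Zd_initial n : set 'rV[R]_d) - counting (unclaimed n phi))%E.

Lemma measurable_recovered_count : measurable_fun [set: N] recovered_count.
Proof.
apply: measurable_fun_limn_esup => n; apply: emeasurable_funB; first exact: measurable_cst.
have rid : rset (fun phi : N => pts phi) by apply: rset_lfset; exact: measurable_id.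
have rZ := rset_Zd R d (N : measurableType _).
apply: measurable_counting; rewrite /unclaimed.
apply: (rset_filter (Q := fun (phi : N) x =>
  ~ exists z, (Zd z /\ ~ Zd_initial n z) /\ matched Zd (pts phi) z x)) => // x rx.
apply: mprop_not; apply: (mprop_exists_in (S := fun _ : N => [set z | Zd z /\ ~ Zd_initial n z])
  (Q := fun phi z => matched Zd (pts phi) z (x phi))) => [|z rz].
  apply: (rset_filter (Q := fun _ z => ~ Zd_initial n z)) => // z rz.
  apply/mprop_not/mprop_exists => v; apply: mprop_and; first exact: mprop_const.
  by apply: mprop_eq => //; exact: rpoint_cst.
exact: (mprop_matched (phi := fun _ : N => Zd)).
Qed.

Lemma recovered_countE (psi : N) (r : R) :
  (forall z, Zd z -> exists t, matched Zd (pts psi) z t) ->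
  finite_set [set z | Zd z /\ flower Zd psi z `&` cball 0 r <> set0] ->
  lfcount (cball 0 r) (lfmatched Zd psi) =
  recovered_count (lfrestrict (~` cball 0 r) (lfmatched Zd psi)).
Proof.
move=> all_matched meet_fin.
have [n0 n0P] := Zd_initial_exhaust meet_fin (fun _ => @proj1 _ _).
pose psi' := lfrestrict (~` cball 0 r) (lfmatched Zd psi).
pose u n : \bar R :=
  (counting (Zd_initial n : set 'rV[R]_d) - counting (unclaimed n psi'))%E.
have ucst : \forall n \near \oo, u n = lfcount (cball 0 r) (lfmatched Zd psi).
  exists n0 => // n /= /n0P meetW; apply/esym.
  apply: counting_matched_points => //.
  - exact: Zd_locally_finite.
  - exact: lfsetP.
  - exact: Zd_initial_sub.
  - exact: finite_Zd_initial.
  - by move=> z Zz nWz; apply: contrapT => meet; apply: nWz; apply: meetW.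
have ucvg : u @ \oo --> lfcount (cball 0 r) (lfmatched Zd psi) by exact: cvg_near_cst.
rewrite /recovered_count -/psi' -/u is_cvg_limn_esupE; last exact: cvgP ucvg.
exact/esym/cvg_lim.
Qed.

End Recovery.

(** * Almost sure consequences of stationarity and summability *)

Section AlmostSure.
Context (R : realType) (d : nat) (d_gt0 : (0 < d)%N) (disp : measure_display)
  (Omega : measurableType disp) (P : probability Omega R) (Psi : Omega -> lfset R d).
Hypotheses (Psi_pp : point_process Psi) (Psi_stationary : stationary P Psi).
Hypothesis flower_summable : (\esum_(w in (Zd : set 'rV[R]_d))
  P [set omega | ~ (flower Zd (Psi omega) 0%R `<=` cball 0%R (enorm w))] < +oo)%E.
Local Notation point := 'rV[R]_d.

Let escape (z : point) (s : R) :=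
  [set omega | ~ (flower Zd (Psi omega) z `<=` cball z s)].

Let measurable_escape z s : Zd z -> measurable (escape z s).
Proof.
move=> Zz; apply: (mprop_flower_not_sub (phi := fun=> Zd)) => //.
- exact: rset_Zd.
- exact: rset_lfset.
Qed.

Let escape_stationary z s : Zd z -> P (escape z s) = P (escape 0 s).
Proof.
move=> Zz.
have mE : measurable [set psi : lfset R d | ~ (flower Zd psi 0 `<=` cball 0 s)].
  apply: (mprop_flower_not_sub (phi := fun _ : lfset R d => Zd)) => //.
  - exact: rset_Zd.
  - by apply: rset_lfset; exact: measurable_id.
  - by move=> _; exact: Zd0.
have := Psi_stationary (- z) mE; rewrite /pushforward => <-; congr (P _).
by apply/seteqP; split => omega; rewrite /escape/= flower_lfshift.
Qed.

(** By stationarity the probability does not depend on the centre [f u], so the summability at 0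
    serves every [f]. A constant [f] yields matchedness, and [2u + v] yields the flower bound. *)
Let ae_finite_escape (f : point -> point) : (forall u, Zd u -> Zd (f u)) ->
  {ae P, forall omega, finite_set [set u | Zd u /\ escape (f u) (enorm u) omega]}.
Proof.
move=> Zf; apply: (borel_cantelli_esum (E := fun u => escape (f u) (enorm u))).
- exact: countable_Zd.
- exact: infinite_Zd.
- by move=> u /Zf; exact: measurable_escape.
- apply: le_lt_trans flower_summable; apply: le_esum => u Zu.
  apply: (@le_trans _ _ (P (escape (f u) (enorm u)))) => //.
  by rewrite (escape_stationary _ (Zf _ Zu)).
Qed.

(** The flower of an unmatched [z] escapes every ball, so with [f] constantly [z] every lattice
    point [u] would belong to a finite set. *)
Lemma ae_all_matched :
  {ae P, forall omega, forall z, Zd z -> exists t, matched Zd (Psi omega) z t}.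
Proof.
have : {ae P, forall omega, forall v : 'rV[int]_d,
    exists t, matched Zd (Psi omega) (map_mx intr v) t}.
  apply: ae_forall_countType => v.
  have Zv : Zd (map_mx intr v : point) by apply/ZdP; exists v.
  apply: filterS (ae_finite_escape (fun _ _ => Zv)) => omega fin.
  apply: contrapT => /(tau_NoneP _ Zv) tauN.
  apply: (infinite_Zd d_gt0); apply: sub_finite_set fin => u Zu; split => //.
  by rewrite /escape/= /flower tauN; exact: setT_not_sub_cball.
by apply: filterS => omega all z /ZdP [v ->].
Qed.

Lemma ae_finite_flower_meet (r : R) : {ae P, forall omega,
  finite_set [set z | Zd z /\ flower Zd (Psi omega) z `&` cball 0 r <> set0]}.
Proof.
have : {ae P, forall omega, forall v : 'rV[int]_d, finite_set [set u : point | Zd u /\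
    escape (2 *: u + map_mx intr v) (enorm u) omega]}.
  apply: ae_forall_countType => v; apply: ae_finite_escape => u Zu.
  rewrite scaler_nat mulr2n; apply: ZdD; first exact: ZdD.
  by apply/ZdP; exists v.
by apply: filterS => omega; exact: finite_flower_meet.
Qed.

End AlmostSure.

(** * Number rigidity of the matched points *)

Local Open Scope ereal_scope.

Theorem theorem7p1 (R : realType) (d : nat) (d_gt0 : (0 < d)%N)
    (disp : measure_display) (Omega : measurableType disp)
    (P : probability Omega R) (Psi : Omega -> lfset R d)
    (Psi_pp : point_process Psi)
    (Psi_stationary : stationary P Psi)
    (Psi_intensity : 1 <= intensity P Psi)
    (flower_summable :
      \esum_(w in (Zd : set 'rV[R]_d))
        P [set omega | ~ (flower Zd (Psi omega) 0%R
                            `<=` cball 0%R (enorm w))] < +oo) :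
  point_process (fun omega => lfmatched Zd (Psi omega)) /\
  number_rigid P (fun omega => lfmatched Zd (Psi omega)).
Proof.
split.
  apply: measurable_fun_rset_lfset.
  by apply: (rset_matched_points (phi := fun=> Zd)); [exact: rset_Zd|exact: rset_lfset].
(* One function serves all radii: the ball enters only through the restricted configuration. *)
move=> r _; exists (@recovered_count R d); first exact: measurable_recovered_count.
apply: filterS2 (ae_all_matched d_gt0 Psi_pp Psi_stationary flower_summable)
  (ae_finite_flower_meet d_gt0 Psi_pp Psi_stationary flower_summable r).
by move=> omega; exact: recovered_countE.
Qed.
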